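(* Let $\{X_t\}$ be a Markov chain on a countable state space $\Sigma$ satisfying the Lyapunov assumption (stated in the context) with finite set $B$. Let $i\in B$, $\epsilon,\alpha\in(0,1)$, and run $\mathrm{IteratedRefinement}(i,\epsilon,\alpha)$. With probability greater than $1-\alpha$, for all iterations $k$, $$\left|\frac{\hat\pi_i^{(k)}-\pi_i}{\hat\pi_i^{(k)}}\right|\le4(1-\epsilon)\left(\frac{2^{-\theta^{(k)}/R_i}}{1-2^{-1/R_i}}\right)\pi_i+\epsilon.$$
   Context: Chain: $\{X_t\}_{t\ge0}$ is a discrete-time, positive recurrent Markov chain with unique stationary distribution $\pi$; $\mathbb P_i(\cdot)=\mathbb P(\cdot\mid X_0=i)$, $\mathbb E_i[\cdot]=\mathbb E[\cdot\mid X_0=i]$; $T_i=\inf\{t\ge1:X_t=i\}$. Lyapunov assumption: $\{X_t\}$ is irreducible and there exist $V:\Sigma\to\mathbb R_+$ and constants $\nu_{\max},\gamma>0$, $b\ge0$ such that (1) $B=\{x\in\Sigma:V(x)\le b\}$ is finite; (2) $|V(y)-V(x)|\le\nu_{\max}$ whenever $\mathbb P(X_{t+1}=y\mid X_t=x)>0$; (3) $\mathbb E[V(X_{t+1})-V(X_t)\mid X_t=x]<-\gamma$ for all $x$ with $V(x)>b$. Constant $R_i$ ($i\in B$): a positive constant for which $\mathbb P_i(T_i>k)\le4\cdot2^{-k/R_i}$ for all positive integers $k$, with $R_i=O\left(\frac{H_i^Be^{2\eta\nu_{\max}}}{(1-\rho)(e^{\eta\nu_{\max}}-\rho)}\right)$,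 where $\eta=\frac{\gamma}{2(e-2)\nu_{\max}^2}$, $\rho=1-\frac{\gamma^2}{4(e-2)\nu_{\max}^2}$, and $H_i^B=\max_{j\in B}\mathbb E_j[T_i^B]$ with $T_i^B=\inf\{t\ge1:Y_t=i\}$ for the chain $\{Y_t\}$ obtained by observing $\{X_t\}$ only at its successive visits to $B$. Algorithm $\mathrm{IteratedRefinement}(i,\epsilon,\alpha)$: iterations $k=1,2,\dots$ with truncation thresholds $\theta^{(k)}=2^k$ and sample sizes $N^{(1)}=\lceil 6(1+\epsilon)\ln(8/\alpha)/\epsilon^2\rceil$, $N^{(k+1)}=\lceil 3(1+\epsilon)\theta^{(k+1)}\ln(4\theta^{(k+1)}/\alpha)/(\hat T_i^{(k)}\epsilon^2)\rceil$. In iteration $k$, $N^{(k)}$ fresh independent realizations of the chain started at $X_0=i$ are simulated, each stopped at the first time $t\ge1$ with $t=\theta^{(k)}$ or $X_t=i$; the $s$-th has length $t_s$ distributed as $\min(T_i,\theta^{(k)})$. Set $\hat T_i^{(k)}=\frac1{N^{(k)}}\sum_{s=1}^{N^{(k)}}t_s$ and $\hat\pi_i^{(k)}=1/\hat T_i^{(k)}$. *)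

(* Defs.v *)
From HB Require Import structures.
From mathcomp Require Import all_boot all_order all_algebra.
From mathcomp Require Import all_classical all_reals all_analysis.

Set Implicit Arguments.
Unset Strict Implicit.
Unset Printing Implicit Defensive.

Import Order.TTheory GRing.Theory Num.Theory.
Local Open Scope classical_set_scope.
Local Open Scope ring_scope.

Section Chains.
Context {R : realType} {S : countType}.
Implicit Types (p : S -> S -> R) (pi : S -> R).

Definition transition_matrix p : Prop :=
  (forall x y, 0 <= p x y) /\
  (forall x, \esum_(y in [set: S]) (p x y)%:E = 1%E).

(* S carries the discrete sigma-algebra.  The Markov property is multiplied
   out, so that nothing is required when the conditioning event is null. *)
Definition markov_chain p (i : S) (d : measure_display) (T : measurableType d)
    (P : probability T R) (X : nat -> T -> S) : Prop :=
  [/\ forall t (A : set S), measurable (X t @^-1` A),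
      P [set w | X 0%N w = i] = 1%E
    & forall (n : nat) (x : nat -> S) (y : S),
        P [set w | (forall t, (t <= n)%N -> X t w = x t) /\ X n.+1 w = y] =
        (P [set w | forall t, (t <= n)%N -> X t w = x t]
          * (p (x n) y)%:E)%E].

(* [Pr i] is the law P( . | X_0 = i) of the chain. *)
Definition markov_family p (d : measure_display) (T : measurableType d)
    (Pr : S -> probability T R) (X : nat -> T -> S) : Prop :=
  transition_matrix p /\ forall i, markov_chain p i (Pr i) X.

Definition irreducible_chain (d : measure_display) (T : measurableType d)
    (Pr : S -> probability T R) (X : nat -> T -> S) : Prop :=
  forall x y, exists n, (0 < Pr x [set w | X n w = y])%E.

Definition stationary p pi : Prop :=
  [/\ forall x, 0 <= pi x,
      \esum_(x in [set: S]) (pi x)%:E = 1%E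
    & forall y, \esum_(x in [set: S]) (pi x * p x y)%:E = (pi y)%:E].

Definition unique_stationary p pi : Prop :=
  stationary p pi /\ forall pi', stationary p pi' -> pi' =1 pi.

(* Equal to +oo if the sequence does not visit a at a positive time. *)
Definition first_return {U : Type} (x : nat -> U) (a : U) : \bar R :=
  ereal_inf [set t%:R%:E | t in [set t : nat | (0 < t)%N /\ x t = a]].

Definition return_time (T : Type) (X : nat -> T -> S) (i : S) (w : T)
    : \bar R :=
  first_return (X ^~ w) i.

Definition positive_recurrent (d : measure_display) (T : measurableType d)
    (Pr : S -> probability T R) (X : nat -> T -> S) : Prop :=
  forall x, (\int[Pr x]_w return_time X x w < +oo)%E.

(* For a chain started at x, E_x[V(X_1) - V(X_0)] is
   E[V(X_(t+1)) - V(X_t) | X_t = x], the chain being homogeneous. *)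
Definition lyapunov p (d : measure_display) (T : measurableType d)
    (Pr : S -> probability T R) (X : nat -> T -> S)
    (V : S -> R) (nu gamma b : R) : Prop :=
  [/\ [/\ 0 < nu, 0 < gamma & 0 <= b],
      forall x, 0 <= V x,
      finite_set [set x | V x <= b],
      forall x y, 0 < p x y -> `|V y - V x| <= nu
    & forall x, b < V x ->
        ('E_(Pr x)[fun w => (V (X 1%N w) - V (X 0%N w))%R] < (- gamma)%:E)%E].

End Chains.

Section ObservedChain.
Context {S : countType}.
Implicit Types (B : set S) (x : nat -> S).

Definition first_visit_from B x (m : nat) : option nat :=
  if pselect (exists t, (m <= t)%N && `[< B (x t) >]) is left h
  then Some (ex_minn h) else None.

(* Time of visit number n (counted from 0); None if there are fewer visits. *)
Fixpoint visit_time B x (n : nat) : option nat :=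
  if n is m.+1 then
    if visit_time B x m is Some t then first_visit_from B x t.+1 else None
  else first_visit_from B x 0.

Definition observed B x (n : nat) : option S := omap x (visit_time B x n).

End ObservedChain.

Section RateConstant.
Context {R : realType} {S : countType}.

Definition observed_return_time (T : Type) (X : nat -> T -> S) (B : set S)
    (i : S) (w : T) : \bar R :=
  first_return (observed B (X ^~ w)) (Some i).

(* The supremum is a maximum, as it is used for finite B only. *)
Definition max_observed_return (d : measure_display) (T : measurableType d)
    (Pr : S -> probability T R) (X : nat -> T -> S) (B : set S) (i : S)
    : \bar R :=
  ereal_sup [set (\int[Pr j]_w observed_return_time X B i w)%E | j in B].

Definition eta_const (nu gamma : R) : R :=
  gamma / (2 * (expR 1 - 2) * nu ^+ 2).

Definition rho_const (nu gamma : R) : R :=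
  1 - gamma ^+ 2 / (4 * (expR 1 - 2) * nu ^+ 2).

Definition rate_bound (H : \bar R) (nu gamma : R) : \bar R :=
  let eta := eta_const nu gamma in
  let rho := rho_const nu gamma in
  (H * (expR (2 * eta * nu)
        / ((1 - rho) * (expR (eta * nu) - rho)))%:E)%E.

Definition return_tail (d : measure_display) (T : measurableType d)
    (Pr : S -> probability T R) (X : nat -> T -> S) (i : S) (Ri : R) : Prop :=
  forall k : nat, (0 < k)%N ->
    (Pr i [set w | ((k%:R : R)%:E < return_time X i w)%E]
      <= (4 * 2 `^ (- k%:R / Ri))%:E)%E.

End RateConstant.

Section IteratedRefinement.
Context {R : realType} {S : countType}.

Definition theta (k : nat) : nat := (2 ^ k)%N.

(* First t >= 1 with t = n or x t = i (for n >= 1): find returns the index in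
   [:: 1; ...; n] of the first such t, that is t - 1. *)
Definition stopped_length (x : nat -> S) (i : S) (n : nat) : nat :=
  (find (fun t => (t == n) || (x t == i)) (iota 1 n)).+1.

(* In what follows z k s is the trajectory number s (counted from 0) which is
   available to iteration k. *)
Definition mean_length (z : nat -> nat -> nat -> S) (i : S) (k N : nat) : R :=
  (\sum_(s < N) (stopped_length (z k s) i (theta k))%:R) / N%:R.

(* Iterations are numbered from 1; the value at k = 0 is irrelevant. *)
Fixpoint sample_size (eps alpha : R) (z : nat -> nat -> nat -> S) (i : S)
    (k : nat) : nat :=
  if k is k'.+1 then
    if k' is 0%N then
      `| Num.ceil (6 * (1 + eps) * ln (8 / alpha) / eps ^+ 2) |%N
    else
      `| Num.ceil (3 * (1 + eps) * (theta k)%:R * ln (4 * (theta k)%:R / alpha)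
           / (mean_length z i k' (sample_size eps alpha z i k')
              * eps ^+ 2)) |%N
  else 0%N.

Definition T_hat (eps alpha : R) (z : nat -> nat -> nat -> S) (i : S)
    (k : nat) : R :=
  mean_length z i k (sample_size eps alpha z i k).

Definition pi_hat (eps alpha : R) (z : nat -> nat -> nat -> S) (i : S)
    (k : nat) : R :=
  (T_hat eps alpha z i k)^-1.

Definition process_sigma (T : Type) (X : nat -> T -> S) : set (set T) :=
  <<s [set E | exists t (A : set S), E = X t @^-1` A] >>.

Definition independent_processes (d : measure_display) (T : measurableType d)
    (P : probability T R) (I : choiceType) (X : I -> nat -> T -> S) : Prop :=
  forall (J : seq I) (E : I -> set T), uniq J ->
    (forall j, j \in J -> process_sigma (X j) (E j)) ->
    P (\bigcap_(j in [set` J]) E j) = (\prod_(j <- J) P (E j))%E.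

(* Z k s t w is the state at time t of realization s of iteration k.  The
   algorithm reads the realizations s < N^(k) of row k only, N^(k) being
   determined by the rows before k. *)
Definition simulations (p : S -> S -> R) (i : S) (d : measure_display)
    (T : measurableType d) (Q : probability T R)
    (Z : nat -> nat -> nat -> T -> S) : Prop :=
  (forall k s, markov_chain p i Q (Z k s)) /\
  independent_processes Q (fun ks : nat * nat => Z ks.1 ks.2).

End IteratedRefinement.

(* Main.v *)
Require Import Defs.
From HB Require Import structures.
From mathcomp Require Import all_boot all_order all_algebra.
From mathcomp Require Import all_classical all_reals all_analysis.
From mathcomp Require Import measurable_realfun ring lra.

Set Implicit Arguments.
Unset Strict Implicit.
Unset Printing Implicit Defensive.

Import Order.TTheory GRing.Theory Num.Theory.
Local Open Scope classical_set_scope.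
Local Open Scope ring_scope.

(* Let u_n(x) = P_x(T_i > n); it is obtained by iterating the transition
   operator killed at i.

   Tail constant.  Let g(x) be the expected number of visits to B before the
   return to i; h = max_B g is at most H_i^B and g <= h everywhere.  The drift
   condition gives U = exp(gamma (V - b) / (4 nu^2)) with P U <= (1 - q) U off B
   and P U <= 2 on B.  In W = 1 + U / (4 h) + g / h the term U / (4 h) supplies
   the decrease off B and g / h the one on B: killed at i, W is contracted by
   1 - min(q, 1) / (12 h), while 1 <= W and W(i) <= 4.

   Accuracy.  Stationarity gives 1 - pi_i E_i[min(T_i, theta)]
   = pi_i sum_(n >= theta) u_n(i), which the tail bound controls.  Chernoff's
   bound for the mean of the N^(k) lengths, applied conditionally on the
   outcomes of the previous iterations (which determine N^(k)), shows that the
   first failure occurs at iteration k with probability at most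
   alpha / 2^(k+1), so some iteration fails with probability at most
   alpha / 2. *)

(** * Sums over a countable type *)

Section CountableSums.
Context {R : realType} {S : countType}.
Local Open Scope ereal_scope.
Implicit Types (f : S -> \bar R).

(** The drift condition controls excursions outside B but says nothing about how the chain gets from
    B to i. The occupation of B fills this gap, and it is how H_i^B enters R_i. Occupations carry a
    finite horizon throughout, so that the contraction is an induction on n without any limit. The
    exponent gamma / (4 nu^2) differs from eta: it minimises a quadratic bound on the exponential
    drift. The rate so obtained is compared with the required expression at the end, at the cost of
    a numerical constant, 3840 = 12 * 320.

    The form (1 - epsilon) a + epsilon of the error comes from 1 - pi_i T = (1 - pi_i m) - pi_i (T -
    m), where T is the estimate, m = E_i[min(T_i, theta)], a = 1 - pi_i m and |T - m| <= epsilon m: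
    the two terms are a and at most epsilon (1 - a).

    Since N^(k) depends on the data, Chernoff's bound cannot be applied to T directly. Lengths are
    bounded integers, so conditioning on the past reduces to finite sums over records of earlier
    lengths. *)

Lemma esum_pickle f : (forall y, 0 <= f y) ->
  \esum_(y in [set: S]) f y = \sum_(n <oo) oapp f 0 (pickle_inv n).
Proof.
move=> f0.
rewrite nneseries_esumT; last by move=> n; case: pickle_inv => /=.
have injS : set_inj [set: S] (@pickle S).
  by move=> x y _ _; exact: (pcan_inj pickleK).
transitivity (\esum_(n in @pickle S @` [set: S]) oapp f 0 (pickle_inv n)).
  rewrite esum_image//; apply: eq_esum => y _.
  by rewrite pickleK_inv.
rewrite esum_mkcond; apply: eq_esum => n _.
case: ifPn => //; rewrite notin_setE => nS.
case E : (pickle_inv n) => [y|]//=; exfalso; apply: nS; exists y => //.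
by have := @pickle_invK S n; rewrite E.
Qed.

Lemma esumZl (I : set S) (c : R) f :
  (0 <= c)%R -> (forall y, 0 <= f y) ->
  \esum_(y in I) (c%:E * f y) = c%:E * \esum_(y in I) f y.
Proof.
move=> c0 f0; rewrite esum_mkcond [X in _ = _ * X]esum_mkcond.
rewrite [LHS]esum_pickle; last first.
  by move=> y; case: ifP => // _; rewrite mule_ge0.
rewrite [X in _ = _ * X]esum_pickle; last by move=> y; case: ifP.
rewrite -nneseriesZl; last first.
  by move=> n _; case: (pickle_inv n) => //= y; case: ifP.
apply: eq_eseriesr => n _; case: (pickle_inv n) => [y|]/=; last by rewrite mule0.
by case: ifP; rewrite ?mule0.
Qed.

Lemma esum_ge1 (I : set S) f x : (forall y, 0 <= f y) -> I x ->
  f x <= \esum_(y in I) f y.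
Proof.
move=> f0 Ix; apply: esum_ge; exists [set x]; last by rewrite fsbig_set1.
by split; [exact: finite_set1|move=> _ ->].
Qed.

Lemma measure_countable_bigcup d (T : measurableType d)
    (P : {measure set T -> \bar R}) (I : set S) (F : S -> set T) :
  (forall y, measurable (F y)) -> trivIset setT F ->
  P (\bigcup_(y in I) F y) = \esum_(y in I) P (F y).
Proof.
move=> mF tF; rewrite esum_mkcond esum_pickle; last by move=> y; case: ifP.
pose G n := oapp (fun y => if y \in I then F y else set0) set0 (@pickle_inv S n).
have -> : \bigcup_(y in I) F y = \bigcup_n G n.
  apply/seteqP; split => [w [y Iy Fyw]|w [n _]].
    by exists (pickle y) => //; rewrite /G pickleK_inv /= mem_set.
  rewrite /G; case: pickle_inv => [y|]//=.
  by case: ifPn => // /set_mem Iy Fyw; exists y.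
rewrite measure_bigcup//.
- apply: congr_lim; apply/funext => k; apply: eq_big => [n|n _]; first by rewrite in_setT.
  rewrite /G; case: pickle_inv => [y|]//=.
  by case: ifP.
- by move=> n _; rewrite /G; case: pickle_inv => [y|]//=; case: ifP.
apply/trivIsetP => a b _ _ ab; rewrite /G.
have := @pickle_invK S a; have := @pickle_invK S b.
case: (pickle_inv a) => [y|]/=; last by rewrite set0I.
case: (pickle_inv b) => [z|]/=; last by rewrite setI0.
move=> zb ya; case: ifP => _; last by rewrite set0I.
case: ifP => _; last by rewrite setI0.
move/trivIsetP: tF; apply => //.
by apply: contra ab => /eqP yz; rewrite -ya -zb yz.
Qed.

Lemma ge0_integral_countable d (T : measurableType d)
    (P : {measure set T -> \bar R}) (Y : T -> S) f :
  (forall A : set S, measurable (Y @^-1` A)) -> (forall y, 0 <= f y) ->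
  \int[P]_w f (Y w) = \esum_(y in [set: S]) (P (Y @^-1` [set y]) * f y).
Proof.
move=> mY f0.
rewrite esum_pickle; last by move=> y; rewrite mule_ge0.
pose G n := oapp (fun y => Y @^-1` [set y]) set0 (@pickle_inv S n).
have mG n : measurable (G n) by rewrite /G; case: pickle_inv => //=.
have <- : \bigcup_n G n = setT.
  apply/seteqP; split => // w _; exists (pickle (Y w)) => //.
  by rewrite /G pickleK_inv.
have mf : measurable_fun [set: T] (f \o Y).
  move=> _ A mA; rewrite setTI.
  exact: mY (f @^-1` A).
rewrite ge0_integral_bigcup//.
- apply: eq_eseriesr => n _; rewrite /G; case: (pickle_inv n) => [y|]/=; last first.
    by rewrite integral_set0.
  rewrite (eq_integral (cst (f y))); first by rewrite integral_cst// muleC.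
  by move=> w /set_mem /= ->.
- exact: measurable_funS mf.
- apply/trivIsetP => a b _ _ ab; rewrite /G.
  have := @pickle_invK S a; have := @pickle_invK S b.
  case: (pickle_inv a) => [y|]/=; last by rewrite set0I.
  case: (pickle_inv b) => [z|]/=; last by rewrite setI0.
  move=> zb ya; rewrite -subset0 => w /= [yw zw].
  by move/eqP: ab; apply; rewrite -ya -zb -yw -zw.
Qed.

Import HBNNSimple.

(* The left-hand side is the integral of a simple function below f. *)
Lemma sum_measure_le_integral d (T : measurableType d)
    (P : {measure set T -> \bar R}) n (E : nat -> set T) (f : T -> \bar R) :
  (forall t, measurable (E t)) ->
  (forall w, (\sum_(t < n) (\1_(E t) w : R))%:E <= f w) ->
  \sum_(t < n) P (E t) <= \int[P]_w f w.
Proof.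
move=> mE ef.
have f0 w : 0 <= f w.
  by apply: le_trans (ef w); rewrite lee_fin sumr_ge0.
pose h := sum_nnsfun (fun t => indic_nnsfun R (mE t)) n.
have hE w : h w = (\sum_(t < n) \1_(E t) w)%R by rewrite sum_nnsfunE.
have -> : \sum_(t < n) P (E t) = sintegral P h.
  rewrite -integralT_nnsfun; under eq_integral do rewrite hE -sumEFin.
  rewrite ge0_integral_sum//.
  - by apply: eq_bigr => t _; rewrite integral_indic// setIT.
  - by move=> t; apply/measurable_EFinP.
rewrite ge0_integralTE//; apply: ereal_sup_ubound; exists h => //.
by move=> w /=; rewrite hE; exact: ef.
Qed.
End CountableSums.

(** * Killed transition operator *)

Lemma probability_setIr d (T : measurableType d) (R : realType)
    (P : probability T R) (A B : set T) :
  measurable A -> measurable B -> P B = 1%E -> P (A `&` B) = P A.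
Proof.
move=> mA mB PB; rewrite [RHS](measureDI P mA mB).
rewrite (@subset_measure0 _ _ _ P (A `\` B) (~` B)) ?add0e//.
- exact: measurableD.
- exact: measurableC.
- by have := probability_setC P mB; rewrite PB subee.
Qed.

Section Taboo.
Context {R : realType} {S : countType}.
Variables (p : S -> S -> R) (D : set S).
Hypothesis p_ge0 : forall x y, 0 <= p x y.
Local Open Scope ereal_scope.
Implicit Types (f g : S -> \bar R) (A : set S).

(** [D] is a parameter because both [[set i]] (the killed chain) and [set0] (the plain transition
    operator, for the drift and for reachability) occur. *)
Definition taboo f x := \esum_(y in ~` D) ((p x y)%:E * f y).

(* visit A n x = P_x(X_n \in A, X_t \notin D for 0 < t <= n) *)
Definition visit A n : S -> \bar R := iter n taboo (fun x => (\1_A x : R)%:E).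

(** Expected number of times t < n spent in [A] before the first visit to [D] at a positive time.
    For [A = setT] and [D = [set i]] this is E_x[min(T_i, n)]. *)
Definition occupation A n x := \sum_(t < n) visit A t x.

Lemma taboo_ge0 f x : (forall y, 0 <= f y) -> 0 <= taboo f x.
Proof. by move=> f0; apply: esum_ge0 => y _; rewrite mule_ge0 ?lee_fin. Qed.

Lemma le_taboo f g x :
  (forall y, (0 < p x y)%R -> f y <= g y) -> taboo f x <= taboo g x.
Proof.
move=> fg; apply: le_esum => y _.
have := p_ge0 x y; rewrite le_eqVlt => /predU1P[<-|pxy]; first by rewrite !mul0e.
by apply: lee_wpmul2l; [rewrite lee_fin ltW|exact: fg].
Qed.

Lemma tabooD f g x : (forall y, 0 <= f y) -> (forall y, 0 <= g y) ->
  taboo (fun y => f y + g y) x = taboo f x + taboo g x.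
Proof.
move=> f0 g0; rewrite /taboo -esumD.
- by apply: eq_esum => y _; rewrite ge0_muleDr.
- by move=> y _; rewrite mule_ge0 ?lee_fin.
- by move=> y _; rewrite mule_ge0 ?lee_fin.
Qed.

Lemma tabooZ (c : R) f x : (0 <= c)%R -> (forall y, 0 <= f y) ->
  taboo (fun y => c%:E * f y) x = c%:E * taboo f x.
Proof.
move=> c0 f0; rewrite /taboo -esumZl//.
- by apply: eq_esum => y _; rewrite muleCA.
- by move=> y; rewrite mule_ge0 ?lee_fin.
Qed.

Lemma taboo_le_esum f x : (forall y, 0 <= f y) ->
  taboo f x <= \esum_(y in [set: S]) ((p x y)%:E * f y).
Proof.
move=> f0; rewrite /taboo esum_mkcond; apply: le_esum => y _.
by case: ifP => // _; rewrite mule_ge0 ?lee_fin.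
Qed.

Lemma taboo_ge1 f x y : (forall y, 0 <= f y) -> ~ D y ->
  (p x y)%:E * f y <= taboo f x.
Proof.
move=> f0 yi; apply: (@esum_ge1 R S _ (fun y => (p x y)%:E * f y)) => //.
by move=> z; rewrite mule_ge0 ?lee_fin.
Qed.

Lemma visit_ge0 A n x : 0 <= visit A n x.
Proof.
elim: n x => [|n IH] x /=; first by rewrite lee_fin.
exact: taboo_ge0.
Qed.

Lemma visit_le1 A n x : (forall x, \esum_(y in [set: S]) (p x y)%:E = 1) ->
  visit A n x <= 1.
Proof.
move=> p1; elim: n x => [|n IH] x /=.
  by rewrite lee_fin indicE; case: (_ \in _).
rewrite -(p1 x); apply: le_trans (_ : taboo (cst 1) x <= _).
  by apply: le_taboo.
apply: le_trans (taboo_le_esum _ _) _ => //.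
by apply: le_esum => y _ /=; rewrite mule1.
Qed.

Lemma le_visit A A' n x : A `<=` A' -> visit A n x <= visit A' n x.
Proof.
move=> AA'; elim: n x => [|n IH] x /=; last exact: le_taboo.
by rewrite lee_fin !indicE ler_nat; case: (boolP (x \in A)) => // /set_mem/AA' /mem_set ->.
Qed.

Lemma occupation_ge0 A n x : 0 <= occupation A n x.
Proof. by apply: sume_ge0 => t _; exact: visit_ge0. Qed.

Lemma occupationS A n x :
  occupation A n.+1 x = (\1_A x : R)%:E + taboo (occupation A n) x.
Proof.
rewrite /occupation big_ord_recl/=; congr (_ + _).
elim: n => [|n IH].
  rewrite big_ord0; apply/esym/esum1 => y _.
  by rewrite big_ord0 mule0.
rewrite big_ord_recr/= IH -tabooD.
- by rewrite /taboo; apply: eq_esum => y _; rewrite big_ord_recr.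
- exact: occupation_ge0.
- exact: visit_ge0.
Qed.

Context (d : measure_display) (T : measurableType d).

Lemma measurable_forall_preimage (X : nat -> T -> S) (I : nat -> Prop)
    (A : nat -> set S) :
  (forall t B, measurable (X t @^-1` B)) ->
  measurable [set w | forall t, I t -> A t (X t w)].
Proof.
move=> mX.
rewrite [X in measurable X](_ : _ = \bigcap_(t in I) X t @^-1` (A t))//.
exact: bigcap_measurableType.
Qed.

Variables (P : probability T R) (X : nat -> T -> S) (x0 : S).
Hypothesis XP : markov_chain p x0 P X.

Let mX t B : measurable (X t @^-1` B). Proof. by case: XP. Qed.

Lemma measurable_avoid (I : nat -> Prop) A n :
  measurable [set w | (forall t, I t -> ~ D (X t w)) /\ A (X n w)].
Proof.
apply: measurableI; last exact: mX.
by apply: (@measurable_forall_preimage _ _ (fun=> ~` D)).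
Qed.

(** The Markov property is given for complete histories, so the induction on [n] carries the whole
    path up to time [m]. One step of it splits the event along the state [y] at time m + 1. *)
Lemma markov_taboo n m (x : nat -> S) A :
  P [set w | (forall t, (t <= m)%N -> X t w = x t) /\
             ((forall t, (m < t <= m + n)%N -> ~ D (X t w)) /\
              A (X (m + n)%N w))]
  = P [set w | forall t, (t <= m)%N -> X t w = x t] * visit A n (x m).
Proof.
elim: n m x => [|n IH] m x.
  rewrite addn0 /= indicE; case: (boolP (x m \in A)) => [|] xmA.
    rewrite mule1; congr (P _); apply/seteqP; split => [w [//]|w /= xw].
    split => //; split => [t /andP[mt tm]|]; last by rewrite xw//; exact/set_mem.
    by move: (leq_ltn_trans tm mt); rewrite ltnn.
  rewrite mule0 (_ : [set w | _] = set0) ?measure0//.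
  apply/seteqP; split => // w [xw [_]].
  by rewrite xw// => /mem_set; apply/negP.
(* The history [x] up to time [m], prolonged by [y]; only its values up to m + 1 are used. *)
pose x' y t := if (t <= m)%N then x t else y.
pose F y := [set w | (forall t, (t <= m.+1)%N -> X t w = x' y t) /\
   ((forall t, (m.+1 < t <= m.+1 + n)%N -> ~ D (X t w)) /\ A (X (m.+1 + n)%N w))].
have -> : [set w | (forall t, (t <= m)%N -> X t w = x t) /\
   ((forall t, (m < t <= m + n.+1)%N -> ~ D (X t w)) /\ A (X (m + n.+1)%N w))]
   = \bigcup_(y in ~` D) F y.
  rewrite addnS -addSn; apply/seteqP; split => [w [xw [wi wA]]|w [y yD [xw [wi wA]]]].
    exists (X m.+1 w); first by apply: wi; rewrite ltnSn /= leq_addr.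
    split; last by split => // t /andP[mt tn]; apply: wi; rewrite tn (ltnW mt).
    move=> t; rewrite /x' leq_eqVlt ltnS; case: leqP => [tm _|_]; first exact: xw.
    by rewrite orbF => /eqP ->.
  split; first by move=> t tm; rewrite xw ?/x' ?tm// leqW.
  split => // t /andP[mt tn]; move: mt; rewrite leq_eqVlt => /predU1P[<-|mt].
    by rewrite xw// /x' ltnn.
  by apply: wi; rewrite mt.
have mF y : measurable (F y).
  apply: measurableI; last exact: measurable_avoid.
  by apply: (@measurable_forall_preimage _ _ (fun t => [set x' y t])).
rewrite measure_countable_bigcup//; last first.
  apply/trivIsetP => a b _ _ /eqP ab; rewrite -subset0 => w [[wa _] [wb _]].
  by apply: ab; move: (wa m.+1 (leqnn _)) (wb m.+1 (leqnn _)); rewrite /x' ltnn => <-.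
set C := [set w | forall t, (t <= m)%N -> X t w = x t].
have PC : P C \is a fin_num.
  rewrite fin_num_measure//.
  by apply: (@measurable_forall_preimage _ _ (fun t => [set x t])).
rewrite -(fineK PC) /= -esumZl//; [|exact: fine_ge0|
  by move=> y; rewrite mule_ge0 ?lee_fin//; exact: visit_ge0].
apply: eq_esum => y _; rewrite /F IH {2}/x' ltnn fineK// muleA; congr (_ * _).
case: XP => _ _ /(_ m x y) <-; congr (P _).
apply/seteqP; split => [w wx|w [wx wy] t].
  by split => [t tm|]; rewrite wx ?/x' ?tm ?ltnn// leqW.
rewrite /x' leq_eqVlt ltnS; case: leqP => [tm _|_]; first exact: wx.
by rewrite orbF => /eqP ->.
Qed.

Lemma markov_visit n A :
  P [set w | (forall t, (0 < t <= n)%N -> ~ D (X t w)) /\ A (X n w)]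
  = visit A n x0.
Proof.
have [_ P0 _] := XP.
have := markov_taboo n 0 (fun=> x0) A; rewrite add0n.
rewrite [X in P X * _](_ : _ = [set w | X 0%N w = x0]); last first.
  by apply/seteqP; split => [w /(_ 0%N)|w X0 t]; [exact|rewrite leqn0 => /eqP ->].
rewrite P0 mul1e => <-.
have mB : measurable [set w | (forall t, (0 < t <= n)%N -> ~ D (X t w)) /\ A (X n w)].
  exact: measurable_avoid.
have m0 : measurable [set w | forall t, (t <= 0)%N -> X t w = x0].
  by apply: (@measurable_forall_preimage _ _ (fun t => [set x0])).
have Pm0 : P [set w | forall t, (t <= 0)%N -> X t w = x0] = 1.
  rewrite -P0; congr (P _).
  by apply/seteqP; split => [w /(_ 0%N)|w X0 t]; [exact|rewrite leqn0 => /eqP ->].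
rewrite -(probability_setIr mB m0 Pm0); congr (P _).
apply/seteqP; split => w [].
  by move=> [wi wA] w0; split.
by move=> w0 [wi wA]; split.
Qed.

Lemma markov_survive n :
  P [set w | forall t, (0 < t <= n)%N -> ~ D (X t w)] = visit setT n x0.
Proof.
rewrite -markov_visit; congr (P _).
by apply/seteqP; split => [w wD|w []].
Qed.
End Taboo.

(** Taking [D = set0] writes the n-step probability as an iterated sum. If it is positive, some
    first step from x to z has positive probability and the remaining n - 1 steps from z do too, so
    induction on n applies. *)
Lemma reachable_closed (R : realType) (S : countType) (p : S -> S -> R)
    (d : measure_display) (T : measurableType d) (Pr : S -> probability T R)
    (X : nat -> T -> S) (F : set S) (x y : S) :
  markov_family p Pr X -> irreducible_chain Pr X ->
  (forall a b, F a -> 0 < p a b -> F b) -> F x -> F y.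
Proof.
move=> [[p0 _] XP] irr Fp Fx.
have [n] := irr x y.
rewrite (_ : [set w | _] =
    [set w | (forall t, (0 < t <= n)%N -> ~ set0 (X t w)) /\ [set y] (X n w)]); last first.
  by apply/seteqP; split => [w yw|w []//]; split => // t _ [].
rewrite (markov_visit set0 p0 (XP x)).
elim: n x Fx => [|n IH] x Fx /=.
  by rewrite lte_fin indicE; case: (boolP (x \in _)) => [/set_mem <-|]//; rewrite ltxx.
rewrite lt0e => /andP[/eqP/(contra_not (@esum1 _ _ _ _)) + _].
move=> /existsNP[z /not_implyP[_ /eqP]]; rewrite mule_eq0 negb_or => /andP[pxz vz].
apply: (IH z); last by rewrite lt0e vz visit_ge0.
by apply: Fp Fx _; rewrite lt0r p0 andbT -eqe.
Qed.

(** * Return times *)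

Section ReturnTimes.
Context {R : realType}.

Lemma first_return_ge (U : Type) (x : nat -> U) (a : U) (c : \bar R) :
  (forall r, (0 < r)%N -> x r = a -> (c <= (r%:R : R)%:E)%E) ->
  (c <= first_return x a)%E.
Proof. by move=> h; apply: le_ereal_inf_tmp => _ [r [r0 xr] <-]; exact: h. Qed.

Lemma first_return_gt (U : Type) (x : nat -> U) (a : U) n :
  ((n%:R : R)%:E < first_return x a)%E <->
  (forall t, (0 < t <= n)%N -> x t <> a).
Proof.
split=> [nr t /andP[t0 tn] xt|h].
  have : (first_return x a <= (t%:R : R)%:E)%E.
    by apply: ereal_inf_lbound; exists t.
  by apply/negP; rewrite -ltNge; apply: le_lt_trans nr; rewrite lee_fin ler_nat.
apply: (@lt_le_trans _ _ (n.+1%:R : R)%:E); first by rewrite lte_fin ltr_nat.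
apply: first_return_ge => r r0 xr; rewrite lee_fin ler_nat ltnNge.
by apply/negP => rn; apply: (h r) => //; rewrite r0.
Qed.

Context {S : countType}.

Lemma first_visit_fromP (B : set S) x m t : first_visit_from B x m = Some t ->
  (m <= t)%N /\ forall s, (m <= s < t)%N -> ~ B (x s).
Proof.
rewrite /first_visit_from; case: pselect => // h [<-].
case: ex_minnP => k /andP[mk Bk] kmin; split=> // s /andP[ms sk] /asboolP Bs.
by have := kmin s; rewrite ms Bs => /(_ isT); rewrite leqNgt sk.
Qed.

Lemma visit_time_count (B : set S) x n t : visit_time B x n = Some t ->
  (n <= t)%N /\ (\sum_(s < t) `[< B (x s) >] <= n)%N.
Proof.
elim: n t => [|n IH] t /=.
  move=> /first_visit_fromP[_ nB]; split => //.
  by rewrite big1// => s _; apply/eqP; rewrite eqb0; apply/asboolPn/nB; rewrite ltn_ord.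
case E : visit_time => [t'|]// /first_visit_fromP[t't nB].
have [nt' ct'] := IH _ E; split; first exact: leq_ltn_trans t't.
rewrite -(big_mkord predT (fun s => `[< B (x s) >] : nat)).
rewrite (big_cat_nat (n := t'.+1))//= [X in (_ + X)%N]big_nat_cond [X in (_ + X)%N]big1 ?addn0.
  rewrite big_mkord big_ord_recr/= -addn1 leq_add//.
  by case: asbool.
move=> s; rewrite andbT => st; apply/eqP; rewrite eqb0.
by apply/asboolPn/nB; rewrite -ltnS.
Qed.

Lemma sum_indic_le (B : set S) (x : nat -> S) n r (E : nat -> Prop) :
  (forall t, (t < n)%N -> E t -> (t < r)%N /\ B (x t)) ->
  (\sum_(t < n) `[< E t >] <= \sum_(t < r) `[< B (x t) >])%N.
Proof.
elim: n r => [|n IH] r h; first by rewrite big_ord0.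
rewrite big_ord_recr/=; case: asboolP => [En|nEn]; last first.
  by rewrite addn0; apply: IH => t tn; apply: h; exact: ltnW.
have [nr Bn] := h n (ltnSn n) En.
rewrite -(subnKC nr) big_split_ord/= big_ord_recr/= asboolT// -addnA leq_add//.
by apply: IH => t tn Et; have [] := h _ (ltnW tn) Et.
Qed.

Context (p : S -> S -> R) (d : measure_display) (T : measurableType d)
  (P : probability T R) (X : nat -> T -> S) (x0 i : S).
Hypothesis p_ge0 : forall x y, 0 <= p x y.
Hypothesis XP : markov_chain p x0 P X.

(** A pointwise comparison of counts suffices: [f] will be a return time, and its measurability is
    never established. *)
Lemma occupation_le_integral (A : set S) n (f : T -> \bar R) :
  (forall w, (((\sum_(t < n) `[< (forall s, (0 < s <= t)%N -> X s w <> i) /\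
     A (X t w) >])%N)%:R : R)%:E <= f w)%E ->
  (occupation p [set i] A n x0 <= \int[P]_w f w)%E.
Proof.
move=> hf; rewrite /occupation.
pose E t := [set w | (forall s, (0 < s <= t)%N -> X s w <> i) /\ A (X t w)].
rewrite (eq_bigr (fun t : 'I_n => P (E t))); last first.
  by move=> t _; rewrite -(markov_visit _ p_ge0 XP).
apply: sum_measure_le_integral => [t|w]; first exact: (measurable_avoid [set i] XP).
apply: le_trans (hf w); rewrite lee_fin natr_sum.
apply: ler_sum => t _; rewrite indicE.
by case: asboolP => h; [rewrite mem_set|rewrite memNset].
Qed.

Lemma occupation_le_return_time n :
  (occupation p [set i] setT n x0 <= \int[P]_w return_time X i w)%E.
Proof.
apply: occupation_le_integral => w; apply: first_return_ge => r r0 xr.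
rewrite lee_fin ler_nat.
pose E t := (forall s, (0 < s <= t)%N -> X s w <> i) /\ [set: S] (X t w).
apply: leq_trans (@sum_indic_le setT (X ^~ w) n r E _) _.
  move=> t _ [ti _]; split => //; rewrite ltnNge; apply/negP => rt.
  by apply: (ti r) => //; rewrite r0.
by rewrite (eq_bigr (fun=> 1%N)) ?sum1_card ?card_ord// => t _; rewrite asboolT.
Qed.

(** If the observed chain is at [i] at its step r > 0, then X is at [i] at a time t >= r, hence
    positive. Visits to [B] counted before killing all precede t, and at most r visits do. *)
Lemma occupation_le_observed_return_time (B : set S) n :
  (occupation p [set i] B n x0 <= \int[P]_w observed_return_time X B i w)%E.
Proof.
apply: occupation_le_integral => w; apply: first_return_ge => r r0.
rewrite /observed; case E : visit_time => [t|]//= [xt].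
have [rt ct] := visit_time_count E.
rewrite lee_fin ler_nat; apply: leq_trans ct.
pose F t := (forall s, (0 < s <= t)%N -> X s w <> i) /\ B (X t w).
apply: (@sum_indic_le B (X ^~ w) n t F) => s _ [si Bs]; split => //.
rewrite ltnNge; apply/negP => ts.
by apply: (si t) => //; rewrite ts (leq_trans r0 rt).
Qed.

Lemma return_time_survive n :
  P [set w | ((n%:R : R)%:E < return_time X i w)%E] =
  visit p [set i] setT n x0.
Proof.
rewrite -(markov_survive _ p_ge0 XP); congr (P _).
by apply/seteqP; split => w /= /first_return_gt.
Qed.

End ReturnTimes.

(** * Kac's formula for truncated return times *)

Section Kac.
Context {R : realType} {S : countType}.
Local Open Scope ereal_scope.

Lemma esum_exchange (A B : set S) (a : S -> S -> \bar R) :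
  (forall x y, 0 <= a x y) ->
  \esum_(x in A) \esum_(y in B) a x y = \esum_(y in B) \esum_(x in A) a x y.
Proof.
move=> a0; rewrite !esum_esum//.
rewrite (@reindex_esum R _ _ (A `*` B) (B `*` A) (fun u => (u.2, u.1)))//.
split=> [[x y] [/= Ax By]|[x y] [x' y'] _ _ [-> ->]//|[y x] [/= By Ax]].
- by split.
- by exists (x, y).
Qed.

Variables (p : S -> S -> R) (pi : S -> R) (i : S).
Hypothesis p_tr : transition_matrix p.
Hypothesis pi_st : stationary p pi.

Let p_ge0 x y : (0 <= p x y)%R. Proof. by case: p_tr. Qed.
Let pi_ge0 x : (0 <= pi x)%R. Proof. by case: pi_st. Qed.

Let u n x := visit p [set i] setT n x.
Let u_ge0 n x : 0 <= u n x. Proof. exact: visit_ge0. Qed.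
Let u_le1 n x : u n x <= 1. Proof. by apply: visit_le1 => //; case: p_tr. Qed.

(** P_pi(X_1, ..., X_n <> i), where pi is the law of X_0. *)
Let a n := \esum_(x in [set: S]) ((pi x)%:E * u n x).

Let a_ge0 n : 0 <= a n.
Proof. by apply: esum_ge0 => x _; rewrite mule_ge0 ?lee_fin. Qed.

(* Stationarity: P_pi(X_1, ..., X_n+1 <> i) = P_pi(X_0, ..., X_n <> i). *)
Lemma stationary_shift n : a n = (pi i)%:E * u n i + a n.+1.
Proof.
rewrite /a (esumID [set i]); last by move=> x _; rewrite mule_ge0 ?lee_fin.
rewrite !setTI esum_set1 ?mule_ge0 ?lee_fin//; congr (_ + _).
have -> : \esum_(x in [set: S]) ((pi x)%:E * u n.+1 x) =
    \esum_(x in [set: S]) \esum_(y in ~` [set i]) ((pi x * p x y)%:E * u n y).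
  apply: eq_esum => x _; rewrite /u /= /taboo -esumZl//.
    by apply: eq_esum => y _; rewrite EFinM muleA.
  by move=> y; rewrite mule_ge0 ?lee_fin// u_ge0.
rewrite esum_exchange => [|x y]; last by rewrite mule_ge0// lee_fin mulr_ge0.
apply: eq_esum => y _; have [_ _ <-] := pi_st.
have uf : u n y \is a fin_num.
  by rewrite ge0_fin_numE//; apply: le_lt_trans (u_le1 n y) _; rewrite ltry.
rewrite -(fineK uf) muleC -esumZl ?fine_ge0//.
  by apply: eq_esum => x _; rewrite muleC.
by move=> x; rewrite lee_fin mulr_ge0.
Qed.

Lemma stationary_occupation m n : (m <= n)%N ->
  a m = (pi i)%:E * \sum_(m <= t < n) u t i + a n.
Proof.
elim: n => [|n IH]; first by rewrite leqn0 => /eqP ->; rewrite big_geq// mule0 add0e.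
rewrite leq_eqVlt => /predU1P[->|]; first by rewrite big_geq// mule0 add0e.
rewrite ltnS => mn; rewrite IH// stationary_shift big_nat_recr//= ge0_muleDr ?addeA//.
by apply: sume_ge0 => t _; exact: u_ge0.
Qed.

(** Telescoping from [a 0 = 1]. It identifies the truncation bias 1 - pi_i E_i[min(T_i, n)] with
    [a n]. *)
Lemma stationary_occupation0 n :
  (pi i)%:E * occupation p [set i] setT n i + a n = 1.
Proof.
rewrite /occupation -(big_mkord predT (fun t => u t i)) -stationary_occupation//.
have [_ <- _] := pi_st; apply: eq_esum => x _.
by rewrite /u /= indicE in_setT mule1.
Qed.

Hypothesis occ_fin : forall x, exists M : R,
  forall n, occupation p [set i] setT n x <= M%:E.

Lemma visit_decr n x : u n.+1 x <= u n x.
Proof.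
elim: n x => [|n IH] x; last by apply: le_taboo => // y _; exact: IH.
by apply: le_trans (u_le1 1 x) _; rewrite /u /= indicE in_setT.
Qed.

(** The survival probabilities decrease in n, so n times the term of index n is at most the sum of
    the n terms before it. This turns a bounded mean return time into the decay M / n. *)
Lemma visit_harmonic (M : R) n x : occupation p [set i] setT n x <= M%:E ->
  n%:R%:E * u n x <= M%:E.
Proof.
apply: le_trans; elim: n => [|n IH]; first by rewrite mul0e occupation_ge0.
rewrite -natr1 EFinD ge0_muleDl ?lee_fin// mul1e /occupation big_ord_recr/=.
apply: leeD; last exact: visit_decr.
by apply: le_trans IH; apply: lee_wpmul2l; [rewrite lee_fin|exact: visit_decr].
Qed.

(** Tightness: a finite set carries all but e / 2 of the mass of pi. On it the bound M(x) / n is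
    uniform; off it the avoidance probability is bounded by 1. *)
Lemma stationary_avoid_cvg0 (e : R) : (0 < e)%R ->
  exists N, forall n, (N <= n)%N -> a n <= e%:E.
Proof.
move=> e0.
have [X finX piX] : exists2 X : set S, finite_set X &
    (1 - e / 2)%:E < \esum_(x in X) (pi x)%:E.
  have : (1 - e / 2)%:E < \esum_(x in [set: S]) (pi x)%:E.
    by have [_ -> _] := pi_st; rewrite lte_fin; lra.
  move=> /ereal_sup_gt[_ [X [finX _] <-] hX]; exists X => //.
  by rewrite esum_fset// => x _; rewrite lee_fin.
have /choice[M HM] := occ_fin.
have M0 x : (0 <= M x)%R.
  by rewrite -lee_fin; apply: le_trans (HM x 0%N); rewrite occupation_ge0.
pose C := (\sum_(x <- finmap.enum_fset (fset_set X)) M x)%R.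
have C0 : (0 <= C)%R by apply: sumr_ge0.
(* From here on n > 2 C / e, that is C / n < e / 2, where C dominates every M(x) on the finite
   set. *)
exists (Num.trunc (2 * C / e)).+1 => n Nn.
have n0 : (0 < n%:R :> R)%R by rewrite ltr0n (leq_trans _ Nn).
have Cn : (C / n%:R <= e / 2)%R.
  have : (2 * C / e <= n%:R)%R.
    by apply: ltW; apply: lt_le_trans (truncnS_gt _) _; rewrite ler_nat.
  by rewrite !ler_pdivrMr// => h; lra.
have pi1 : \esum_(x in X) (pi x)%:E + \esum_(x in ~` X) (pi x)%:E = 1.
  by have [_ <- _] := pi_st; rewrite [RHS](esumID X) ?setTI// => x _; rewrite lee_fin.
rewrite /a (esumID X) ?setTI; last by move=> x _; rewrite mule_ge0 ?lee_fin.
have aX : \esum_(x in X) ((pi x)%:E * u n x) <= (e / 2)%:E.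
  apply: le_trans (_ : (C / n%:R)%:E <= _); last by rewrite lee_fin.
  rewrite esum_fset//; last by move=> x _; rewrite mule_ge0 ?lee_fin.
  rewrite fsbig_finite//= /C mulr_suml -sumEFin; apply: lee_sum => x _.
  apply: le_trans (_ : 1 * u n x <= _).
    apply: lee_wpmul2r => //.
    have [_ <- _] := pi_st; apply: (@esum_ge1 R S _ (fun y => (pi y)%:E)) => //.
  by rewrite mul1e EFinM lee_pdivlMr// muleC; exact: visit_harmonic.
have aC : \esum_(x in ~` X) ((pi x)%:E * u n x) <= (e / 2)%:E.
  apply: le_trans (_ : \esum_(x in ~` X) (pi x)%:E <= _).
    apply: le_esum => x _; rewrite -[leRHS]mule1.
    by apply: lee_wpmul2l; rewrite ?lee_fin.
  rewrite leNgt; apply/negP => h; have := lteD piX h.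
  by rewrite pi1 -EFinD lte_fin subrK ltxx.
by apply: le_trans (leeD aX aC) _; rewrite -EFinD -splitr.
Qed.

(** [a th] equals 1 - pi_i m, and it also equals pi_i times the sum of survival probabilities from
    th to n, plus [a n]. The last term vanishes as n grows, which leaves the tail sum. *)
Lemma kac_truncated (th : nat) (m t : R) :
  occupation p [set i] setT th i = m%:E ->
  (forall n, \sum_(th <= k < n) u k i <= t%:E) ->
  (0 <= 1 - pi i * m <= pi i * t)%R.
Proof.
move=> fin_m ut.
have am : a th = (1 - pi i * m)%:E.
  have := stationary_occupation0 th; rewrite fin_m -EFinM.
  by case: (a th) => [r||]//= [<-]; rewrite addrAC subrr add0r.
rewrite -!lee_fin -am a_ge0 /=.
apply/lee_addgt0Pr => e /stationary_avoid_cvg0[N HN].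
rewrite (stationary_occupation (leq_maxl th N)).
apply: leeD; last exact/HN/leq_maxr.
by rewrite EFinM; apply: lee_wpmul2l => //; rewrite lee_fin.
Qed.

End Kac.

(** * Lyapunov drift and geometric tails *)

Section ExpBounds.
Context {R : realType}.
Implicit Types (x : R).

Lemma expR_le_inv1B x : x < 1 -> expR x <= (1 - x)^-1.
Proof.
move=> x1; rewrite -[x]opprK expRN opprK lef_pV2 ?posrE ?expR_gt0 ?subr_gt0//.
exact: expR_ge1Dx.
Qed.

Lemma expR_le_quad x : `|x| <= 1 / 2 -> expR x <= 1 + x + 2 * x ^+ 2.
Proof.
rewrite ler_norml => /andP[x1 x2].
apply: le_trans (expR_le_inv1B _) _; first by lra.
rewrite invf_ple ?posrE; try nra.
rewrite -[leLHS]div1r ler_pdivrMr; nra.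
Qed.

(** Squares the bounds 3/2 <= exp(1/2) <= 2. They serve to keep e - 2, which enters eta and rho,
    between 1/4 and 2. *)
Lemma expR1_bounds : 9 / 4 <= expR (1 : R) <= 4.
Proof.
have -> : expR 1 = expR (1 / 2) ^+ 2 :> R by rewrite -expRM_natl; congr expR; lra.
have h1 : 1 + 1 / 2 <= expR (1 / 2 : R) by exact: expR_ge1Dx.
have h2 : expR (1 / 2 : R) <= (1 - 1 / 2)^-1 by apply: expR_le_inv1B; lra.
have h3 : (1 - 1 / 2)^-1 = 2 :> R by field.
rewrite h3 in h2; nra.
Qed.
End ExpBounds.

Section Drift.
Context {R : realType} {S : countType}.
Variables (p : S -> S -> R).
Hypothesis p_tr : transition_matrix p.

Let p_ge0 x y : (0 <= p x y)%R. Proof. by case: p_tr. Qed.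

Lemma taboo_cst (D : set S) (c : R) x : 0 <= c ->
  (taboo p D (fun=> c%:E) x <= c%:E)%E.
Proof.
move=> c0; apply: le_trans (taboo_le_esum _ p_ge0 _ _) _ => //.
under eq_esum do rewrite muleC.
rewrite esumZl//; first by case: p_tr => _ ->; rewrite mule1.
by move=> y; rewrite lee_fin.
Qed.

Lemma taboo0_cst (c : R) x : 0 <= c -> taboo p set0 (fun=> c%:E) x = c%:E.
Proof.
move=> c0; rewrite /taboo setC0; under eq_esum do rewrite muleC.
rewrite esumZl//; first by case: p_tr => _ ->; rewrite mule1.
by move=> y; rewrite lee_fin.
Qed.

Lemma le_taboo0 (D : set S) (f : S -> \bar R) x : (forall y, 0 <= f y)%E ->
  (taboo p D f x <= taboo p set0 f x)%E.
Proof. by move=> f0; rewrite [leRHS]/taboo setC0; exact: taboo_le_esum. Qed.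

Context (d : measure_display) (T : measurableType d) (Pr : S -> probability T R)
  (X : nat -> T -> S).
Hypothesis PrX : forall x, markov_chain p x (Pr x) X.

Lemma integral_step (f : S -> \bar R) x : (forall y, 0 <= f y)%E ->
  (\int[Pr x]_w f (X 1%N w) = taboo p set0 f x)%E.
Proof.
move=> f0; have [mX P0 PS] := PrX x.
rewrite ge0_integral_countable// /taboo setC0.
apply: eq_esum => y _; congr (_ * _)%E.
have := PS 0%N (fun=> x) y.
rewrite [X in (_ = Pr x X * _)%E -> _](_ : _ = [set w | X 0%N w = x]); last first.
  by apply/seteqP; split => [w /(_ 0%N)|w X0 t]; [exact|rewrite leqn0 => /eqP ->].
rewrite P0 mul1e => <-.
have m0 : measurable [set w | X 0%N w = x] by exact: (mX 0%N [set x]).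
apply: etrans (esym (probability_setIr (mX 1%N [set y]) m0 P0)) _; congr (Pr x _).
apply/seteqP; split => [w [/= X1 X0]|w [X0 /= X1]].
  by split => // t; rewrite leqn0 => /eqP ->.
by split => //=; apply: X0.
Qed.

Lemma measurable_comp_countable (f : S -> R) (x : S) t :
  measurable_fun [set: T] (fun w => f (X t w)).
Proof.
have [mX _ _] := PrX x.
by move=> _ A mA; rewrite setTI; exact: (mX t (f @^-1` A)).
Qed.

(** [taboo] is a sum of nonnegative terms, so the signed increment is handled through its positive
    and negative parts. The start X_0 = x holds almost surely. *)
Lemma expectation_step (f : S -> R) x :
  ('E_(Pr x)[fun w => (f (X 1%N w) - f (X 0%N w))%R] =
   taboo p set0 (fun y => (Num.max (f y - f x) 0)%:E) x
   - taboo p set0 (fun y => (Num.max (f x - f y) 0)%:E) x)%E.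
Proof.
have [mX P0 _] := PrX x.
have mf t : measurable_fun [set: T] (fun w => f (X t w)).
  exact: (measurable_comp_countable _ x).
have mD : measurable_fun [set: T] (fun w => (f (X 1%N w) - f (X 0%N w))%:E).
  by apply/measurable_EFinP; exact: measurable_funB.
have mD' : measurable_fun [set: T] (fun w => (f (X 1%N w) - f x)%:E).
  by apply/measurable_EFinP; exact: measurable_funB.
rewrite unlock; transitivity (\int[Pr x]_w (f (X 1%N w) - f x)%:E)%E.
  apply: ae_eq_integral => //.
  exists [set w | X 0%N w <> x]; split.
  - exact: (mX 0%N (~` [set x])).
  - have := probability_setC (Pr x) (mX 0%N [set x]).
    by rewrite [X in (_ = 1 - X)%E]P0 subee.
  - by move=> w /= h X0; apply: h; rewrite X0.
rewrite integralE -!integral_step => [|y|y]; last 2 first.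
- by rewrite lee_fin le_max lexx orbT.
- by rewrite lee_fin le_max lexx orbT.
congr (_ - _)%E; apply: eq_integral => w _.
  by rewrite funeposE EFin_max.
by rewrite funenegE -EFinN opprB EFin_max.
Qed.

End Drift.

(** * Contraction of the chain killed at i *)

Section GeometricTail.
Context {R : realType} {S : countType}.
Variables (p : S -> S -> R) (d : measure_display) (T : measurableType d)
  (Pr : S -> probability T R) (X : nat -> T -> S) (V : S -> R) (nu gamma b : R).
Hypothesis family : markov_family p Pr X.
Hypothesis lyap : lyapunov p Pr X V nu gamma b.

Let p_tr : transition_matrix p. Proof. by case: family. Qed.
Let p_ge0 x y : 0 <= p x y. Proof. by case: p_tr. Qed.

(** A mean decrease of more than gamma with jumps of size at most nu forces gamma <= nu, so the
    exponent stays within 1/4 and exp v <= 1 + v + 2 v^2 applies. Averaging gives 1 - eta gamma + 2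
    eta^2 nu^2, which is minimal at eta = gamma / (4 nu^2). *)
Lemma lyapunov_drift x : b < V x ->
  gamma <= nu /\
  (taboo p set0 (fun y =>
     (expR (gamma / (4 * nu ^+ 2) * (V y - V x)))%:E) x
   <= (1 - gamma ^+ 2 / (8 * nu ^+ 2))%:E)%E.
Proof.
have [[nu0 gamma0 b0] V0 _ Vnu /[apply]] := lyap.
rewrite (expectation_step (proj2 family)).
set f1 := fun y => _; set f2 := fun y => _.
have f_bound (g : S -> \bar R) :
    (forall y, 0 <= g y)%E -> (forall y, 0 < p x y -> (g y <= nu%:E)%E) ->
    exists2 a : R, 0 <= a & (taboo p set0 g x = a%:E)%E /\ a <= nu.
  move=> g0 gnu.
  have t0 := taboo_ge0 set0 p_ge0 x g0.
  have : (taboo p set0 g x <= nu%:E)%E.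
    apply: le_trans (le_taboo set0 p_ge0 gnu) _.
    by apply: taboo_cst => //; exact: ltW.
  by move: t0; case: (taboo _ _ _ _) => // a; rewrite !lee_fin; exists a.
have f10 y : (0 <= f1 y)%E by rewrite lee_fin le_max lexx orbT.
have f20 y : (0 <= f2 y)%E by rewrite lee_fin le_max lexx orbT.
have [y /Vnu|a a0 [aE _]] := f_bound f1 f10.
  by rewrite ler_norml lee_fin ge_max (ltW nu0) andbT => /andP[].
have [y /Vnu|c c0 [cE cnu]] := f_bound f2 f20.
  by rewrite ler_norml lee_fin ge_max (ltW nu0) andbT => /andP[]; lra.
rewrite aE cE -EFinD lte_fin => ac.
have gnu : gamma <= nu by lra.
split => //.
set eta := gamma / (4 * nu ^+ 2); set g := fun y => _.
have eta0 : 0 < eta by rewrite divr_gt0// mulr_gt0// exprn_gt0.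
have etanu : eta * nu <= 1 / 4.
  rewrite /eta mulrAC expr2 [4 * _]mulrA -mulf_div divff ?gt_eqF// mulr1.
  by rewrite ler_pdivrMr ?mulr_gt0//; lra.
have g0 y : (0 <= g y)%E by rewrite lee_fin expR_ge0.
(* The negative part stands on the left, so that both sides are sums of nonnegative terms and no
   subtraction of extended reals occurs. *)
have sum_le : (taboo p set0 g x + eta%:E * taboo p set0 f2 x <=
    (1 + 2 * (eta * nu) ^+ 2)%:E + eta%:E * taboo p set0 f1 x)%E.
  rewrite -(@taboo0_cst _ _ _ p_tr (1 + 2 * (eta * nu) ^+ 2) x); last first.
    by rewrite addr_ge0// mulr_ge0// sqr_ge0.
  rewrite -!tabooZ ?(ltW eta0)// -!tabooD//.
  - apply: le_taboo => // y /Vnu Vy.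
    rewrite /g /f1 /f2 -!EFinM -!EFinD lee_fin.
    set v := V y - V x.
    have -> : V x - V y = - v by rewrite opprB.
    have vE : Num.max v 0 - Num.max (- v) 0 = v.
      by have [v0|v0] := leP 0 v; case: leP => //; lra.
    have : `|eta * v| <= eta * nu by rewrite normrM gtr0_norm// ler_pM2l.
    move=> etav; have := expR_le_quad (le_trans etav (_ : _ <= 1 / 2)).
    have : (eta * v) ^+ 2 <= (eta * nu) ^+ 2.
      by move: etav; rewrite ler_norml => /andP[h1 h2]; nra.
    have -> : eta * Num.max v 0 = eta * v + eta * Num.max (- v) 0.
      by rewrite -mulrDr -[X in X + _]vE subrK.
    by move=> h1 h2; have {h2} := h2 ltac:(lra); lra.
  - by move=> y; rewrite lee_fin addr_ge0// mulr_ge0// sqr_ge0.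
  - by move=> y; rewrite mule_ge0// lee_fin ltW.
  - by move=> y; rewrite mule_ge0// lee_fin ltW.
rewrite aE cE -!EFinM -EFinD in sum_le.
have : (taboo p set0 g x <= (1 + 2 * (eta * nu) ^+ 2 + eta * a - eta * c)%:E)%E.
  move: sum_le; case: (taboo _ _ g _) => [r|/=|].
  - by rewrite -EFinD !lee_fin; lra.
  - by rewrite addye// leye_eq.
  - by move=> _; rewrite leNye.
move/le_trans; apply; rewrite lee_fin.
have -> : 2 * (eta * nu) ^+ 2 = gamma ^+ 2 / (8 * nu ^+ 2).
  by rewrite /eta; field; rewrite gt_eqF.
have : eta * (a - c) <= eta * (- gamma) by rewrite ler_pM2l// ltW.
have -> : eta * - gamma = - (2 * (gamma ^+ 2 / (8 * nu ^+ 2))).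
  by rewrite /eta; field; rewrite gt_eqF.
by rewrite mulrBr; lra.
Qed.

Let B := [set x | V x <= b].
Variables (i : S) (h : R).
Hypothesis Bi : B i.
Hypothesis occ_h : forall n x, B x -> (occupation p [set i] B n x <= h%:E)%E.

Let occ n x := occupation p [set i] B n x.
Let occ_ge0 n x : (0 <= occ n x)%E. Proof. exact: occupation_ge0. Qed.

(** Maximum principle: a start outside [B] contributes nothing at time 0, so its occupation is an
    average of values with a shorter horizon. *)
Lemma occupation_le n x : (occ n x <= h%:E)%E.
Proof.
elim: n x => [|n IH] x.
  by rewrite /occ /occupation big_ord0; apply: le_trans (occ_h 0 Bi); exact: occ_ge0.
have [Bx|nBx] := pselect (B x); first exact: occ_h.
rewrite /occ occupationS// indicE memNset// add0e.
apply: le_trans (le_taboo _ p_ge0 (fun y _ => IH y)) _.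
apply: taboo_cst => //; rewrite -lee_fin.
by apply: le_trans (occ_h 0 Bi); exact: occ_ge0.
Qed.

Let eta := gamma / (4 * nu ^+ 2).
Let q := gamma ^+ 2 / (8 * nu ^+ 2).
Let U x := expR (eta * (V x - b)).

Let nu0 : 0 < nu. Proof. by case: lyap => -[]. Qed.
Let gamma0 : 0 < gamma. Proof. by case: lyap => -[]. Qed.
Let eta0 : 0 < eta. Proof. by rewrite divr_gt0// mulr_gt0// exprn_gt0. Qed.
Let q0 : 0 < q. Proof. by rewrite divr_gt0 ?exprn_gt0// mulr_gt0// exprn_gt0. Qed.
Let U0 x : 0 <= U x. Proof. exact: expR_ge0. Qed.

Lemma lyapunov_exp_outside x : b < V x ->
  (taboo p [set i] (fun y => (U y)%:E) x <= ((1 - q) * U x)%:E)%E.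
Proof.
move=> bV; have [_ drift] := lyapunov_drift bV.
have -> : (fun y => (U y)%:E) =
    (fun y => (U x)%:E * (expR (eta * (V y - V x)))%:E)%E.
  apply/funext => y; rewrite -EFinM /U -expRD; congr (expR _)%:E; lra.
rewrite tabooZ//.
rewrite mulrC EFinM; apply: lee_wpmul2l; first by rewrite lee_fin.
apply: le_trans drift; exact: le_taboo0.
Qed.

Lemma lyapunov_exp_inside x : V x <= b ->
  (taboo p [set i] (fun y => (U y)%:E) x <= 2%:E)%E.
Proof.
move=> Vx; have [_ _ _ Vnu _] := lyap.
apply: le_trans (_ : taboo p [set i] (fun=> 2%:E) x <= _)%E; last first.
  exact: taboo_cst.
apply: le_taboo => // y /Vnu; rewrite ler_norml lee_fin => /andP[_ Vy].
have [yb|yb] := leP (V y) b.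
  apply: (@le_trans _ _ 1); last by lra.
  by rewrite /U -[leRHS]expR0 ler_expR pmulr_rle0// subr_le0.
(* gamma <= nu follows from the drift at a state outside [B]; here that state is [y]. *)
have [gnu _] := lyapunov_drift yb.
have etanu : eta * nu <= 1 / 4.
  rewrite /eta mulrAC expr2 [4 * _]mulrA -mulf_div divff ?gt_eqF// mulr1.
  by rewrite ler_pdivrMr ?mulr_gt0//; lra.
apply: le_trans (_ : expR (1 / 4) <= _).
  by rewrite ler_expR; apply: le_trans etanu; rewrite ler_pM2l//; lra.
apply: le_trans (expR_le_quad _) _; last by lra.
by rewrite ger0_norm; lra.
Qed.

Let q1 := Num.min q 1.
(** 12 = 4 * 3: the decrease off [B] is q U / (4 h), and W is at most 3 U there and at most 3 on
    [B]. The cap [q1] <= 1 serves on [B], where the decrease is of order 1 / h only. *)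
Let dl := q1 / (12 * h).

(** The g of W is replaced by [occ n], with the same [n] as the survival probability. The induction
    then matches [occupationS], whose indicator of [B] supplies the gain 1 / h on [B]. *)
Lemma survive_le n x : 1 <= h ->
  (visit p [set i] setT n x <= ((1 - dl) ^+ n)%:E *
     ((1 + (4 * h)^-1 * U x)%:E + (h^-1)%:E * occ n x))%E.
Proof.
move=> h1; have h0 : 0 < h by lra.
have q1_0 : 0 < q1 by rewrite lt_min q0 ltr01.
have q1q : q1 <= q by rewrite ge_min lexx.
have q11 : q1 <= 1 by rewrite ge_min lexx orbT.
have dl0 : 0 < dl by rewrite divr_gt0// mulr_gt0.
have dl1 : dl <= 1 / 12 by rewrite ler_pdivrMr ?mulr_gt0//; nra.
have c0 : 0 < (4 * h)^-1 by rewrite invr_gt0 mulr_gt0.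
have hV0 : 0 < h^-1 by rewrite invr_gt0.
have W0 m y : (0 <= (1 + (4 * h)^-1 * U y)%:E + (h^-1)%:E * occ m y)%E.
  by rewrite adde_ge0// ?mule_ge0// lee_fin ?(ltW hV0)// addr_ge0// mulr_ge0// ltW.
elim: n x => [|n IH] x.
  rewrite /= expr0 mul1e indicE in_setT.
  rewrite -[leLHS]adde0; apply: leeD.
    by rewrite lee_fin lerDl mulr_ge0// ltW.
  by rewrite mule_ge0// lee_fin ltW.
apply: le_trans (le_taboo _ p_ge0 (fun y _ => IH y)) _.
have pw0 m : 0 <= (1 - dl) ^+ m by rewrite exprn_ge0//; lra.
rewrite tabooZ// exprSr EFinM -muleA; apply: lee_wpmul2l; first by rewrite lee_fin.
rewrite tabooD//; last 2 first.
- by move=> y; rewrite lee_fin addr_ge0// mulr_ge0// ltW.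
- by move=> y; rewrite mule_ge0// lee_fin ltW.
rewrite (tabooZ _ _ _ (ltW hV0))//.
have -> : taboo p [set i] (fun y => (1 + (4 * h)^-1 * U y)%:E) x =
    (taboo p [set i] (fun=> 1%:E) x +
     (4 * h)^-1%:E * taboo p [set i] (fun y => (U y)%:E) x)%E.
  rewrite -tabooZ ?(ltW c0)// -tabooD//.
  by move=> y; rewrite -EFinM lee_fin mulr_ge0// ltW.
have occS := occupationS [set i] p_ge0 B n x.
have occSh := occupation_le n.+1 x.
have t1 : (taboo p [set i] (fun=> 1%:E) x <= 1%:E)%E by exact: taboo_cst.
have k0 : (0 <= taboo p [set i] (occ n) x)%E by exact: taboo_ge0.
rewrite /occ occS; rewrite /occ occS in occSh.
move: k0 occSh; rewrite -/(occ n); case: (taboo p [set i] (occ n) x) => [k||]//.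
rewrite lee_fin => k0; rewrite -EFinD lee_fin => kh.
have tU_ge0 : (0 <= taboo p [set i] (fun y => (U y)%:E) x)%E.
  by apply: taboo_ge0 => // y; rewrite lee_fin.
(* A real upper bound [tU] for the average of U (2 on [B], (1 - q) U off [B]) leaves an inequality
   between reals. *)
suff [tU [tUE Hle]] : exists tU, (taboo p [set i] (fun y => (U y)%:E) x <= tU%:E)%E /\
    1 + (4 * h)^-1 * tU + h^-1 * k <=
    (1 - dl) * (1 + (4 * h)^-1 * U x + h^-1 * (\1_B x + k)).
  apply: le_trans (_ : ((1 + (4 * h)^-1 * tU + h^-1 * k)%:E <= _)%E); last first.
    by rewrite -!EFinM lee_fin.
  rewrite -EFinM !EFinD [X in (_ <= _ + X + _)%E]EFinM; apply: leeD2r.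
  by apply: leeD => //; apply: lee_wpmul2l => //; rewrite lee_fin ltW.
have hh : h^-1 * h = 1 by rewrite mulVf// gt_eqF.
have c_h : (4 * h)^-1 = h^-1 / 4 by rewrite invfM mulrC.
have dl_h : dl = q1 / 12 * h^-1 by rewrite /dl invfM mulrA.
have h_le1 : h^-1 <= 1 by rewrite invf_le1.
rewrite c_h; set r := h^-1 in hh hV0 h_le1 dl_h *.
have [Bx|nBx] := pselect (B x).
  exists 2; split; first exact: lyapunov_exp_inside.
  move: kh; rewrite indicE mem_set//= => kh.
  have Ux1 : U x <= 1 by rewrite /U -[leRHS]expR0 ler_expR pmulr_rle0// subr_le0.
  have rk : r * (1 + k) <= 1 by rewrite -[leRHS]hh ler_pM2l.
  have rk0 : 0 <= r * k by rewrite mulr_ge0// ltW.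
  have rU0 : 0 <= r * U x by rewrite mulr_ge0// ltW.
  have rU1 : r * U x <= r by rewrite ler_piMr// ltW.
  have dlr : dl <= r / 12.
    by rewrite dl_h mulrAC ler_pM2r// ler_piMl// ltW.
  have : dl * (1 + r / 4 * U x + r * (1 + k)) <= r / 12 * 3.
    by apply: ler_pM => //; lra.
  by lra.
exists ((1 - q) * U x); move/negP: nBx; rewrite -ltNge => bV.
split; first exact: lyapunov_exp_outside.
rewrite indicE memNset/=; last by apply/negP; rewrite -ltNge.
move: kh; rewrite indicE memNset/=; last by apply/negP; rewrite -ltNge.
rewrite !add0r => kh.
have Ux1 : 1 <= U x by rewrite /U -[leLHS]expR0 ler_expR pmulr_rge0// subr_ge0 ltW.
have rk : r * k <= 1 by rewrite -hh ler_pM2l.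
have rk0 : 0 <= r * k by rewrite mulr_ge0// ltW.
have rU0 : 0 <= r * U x by rewrite mulr_ge0// ltW.
have rU1 : r * U x <= U x by rewrite ler_piMl.
have : dl * (1 + r / 4 * U x + r * k) <= q * r / 12 * (3 * U x).
  apply: ler_pM; [lra|lra| |lra].
  by rewrite dl_h mulrAC ler_pM2r// ler_pM2r.
by lra.
Qed.

(** At [i] in [B], U <= 1 and the occupation is at most h, so W(i) <= 3, within the factor 4 allowed
    by [return_tail]. *)
Lemma survive_geometric n : 1 <= h ->
  (visit p [set i] setT n i <= (4 * (1 - dl) ^+ n)%:E)%E.
Proof.
move=> h1; have h0 : 0 < h by lra.
apply: le_trans (survive_le n i h1) _.
have dl1 : dl <= 1.
  rewrite ler_pdivrMr ?mulr_gt0// mul1r.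
  by apply: (@le_trans _ _ 1); [rewrite ge_min lexx orbT|lra].
have pw0 : 0 <= (1 - dl) ^+ n by rewrite exprn_ge0// subr_ge0.
rewrite [X in (_ <= X%:E)%E]mulrC [leRHS]EFinM; apply: lee_wpmul2l; first by rewrite lee_fin.
have hV0 : 0 < h^-1 by rewrite invr_gt0.
have : ((h^-1)%:E * occ n i <= 1%:E)%E.
  rewrite (_ : 1%:E = (h^-1)%:E * h%:E)%E.
    by apply: lee_wpmul2l; [rewrite lee_fin ltW|exact: occupation_le].
  by rewrite -EFinM mulVf// gt_eqF.
move/(leeD2l (1 + (4 * h)^-1 * U i)%:E)/le_trans; apply.
rewrite -EFinD lee_fin.
have Ui1 : U i <= 1 by rewrite /U -[leRHS]expR0 ler_expR pmulr_rle0// subr_le0.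
have : (4 * h)^-1 * U i <= 1 * 1.
  apply: ler_pM => //; first by rewrite invr_ge0 mulr_ge0// ltW.
  by rewrite invf_le1 ?mulr_gt0//; lra.
by lra.
Qed.

End GeometricTail.

(** * Comparison of the decay rate with the expression in eta and rho *)

Section RateConstant.
Context {R : realType}.

Lemma expRN_natr_ge_pow (x : R) n : x <= 1 -> (1 - x) ^+ n <= expR (- (n%:R * x)).
Proof.
move=> x1; rewrite -mulrN expRM_natl; apply: lerXn2r; rewrite ?nnegrE ?expR_ge0//.
  by rewrite subr_ge0.
exact: expR_ge1Dx.
Qed.

(** The choice R_i = ln 2 / x makes 2^(-n / R_i) equal to exp(-n x), which dominates (1 - x)^n. *)
Lemma powR2_rate (x : R) n : x != 0 ->
  2 `^ (- n%:R / (ln 2 / x)) = expR (- (n%:R * x)).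
Proof.
move=> x0; rewrite /powR pnatr_eq0/=; congr expR.
have l2 : ln 2 != 0 :> R by rewrite gt_eqF// ln_gt0// ltr1n.
by field; rewrite x0 l2.
Qed.

(* For small a the left-hand side is of order 1 / a ^ 2 and K of order
   1 / a ^ 3. *)
Lemma rate_constant (nu gamma : R) : 0 < nu -> 0 < gamma ->
  let a := eta_const nu gamma * nu in
  let rho := rho_const nu gamma in
  let K := expR (2 * eta_const nu gamma * nu) / ((1 - rho) * (expR a - rho)) in
  0 < K /\ (Num.min (gamma ^+ 2 / (8 * nu ^+ 2)) 1)^-1 <= 320 * K.
Proof.
move=> nu0 gamma0 a rho K.
have /andP[e1 e2] := @expR1_bounds R.
set s : R := expR 1 - 2.
have s1 : 1 / 4 <= s by rewrite /s; lra.
have s2 : s <= 2 by rewrite /s; lra.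
have s0 : 0 < s by lra.
(* With s = e - 2, all constants become functions of a and s: 1 - rho = s a^2 and q = s^2 a^2 /
   2. *)
have aE : a = gamma / (2 * s * nu).
  by rewrite /a /eta_const -/s; field; rewrite !gt_eqF.
have a0 : 0 < a by rewrite aE divr_gt0// !mulr_gt0.
have rhoE : 1 - rho = s * a ^+ 2.
  by rewrite /rho /rho_const -/s aE; field; rewrite !gt_eqF.
have qE : gamma ^+ 2 / (8 * nu ^+ 2) = s ^+ 2 * a ^+ 2 / 2.
  by rewrite aE; field; rewrite !gt_eqF.
have a2 : 1 + a ^+ 2 / 2 <= expR a.
  by have := expR_ge1Dxn 1 (ltW a0).
have ea0 := expR_gt0 a.
have a2_0 : 0 < a ^+ 2 by rewrite exprn_gt0.
have den0 : 0 < expR a - rho by rewrite (_ : _ - _ = expR a - 1 + (1 - rho)) ?rhoE; nra.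
have den5 : expR a - rho <= 5 * expR a.
  by rewrite (_ : _ - _ = expR a - 1 + (1 - rho)) ?rhoE; nra.
have KE : K = expR a ^+ 2 / (s * a ^+ 2 * (expR a - rho)).
  rewrite /K rhoE -expRM_natl; congr (expR _ / _).
  by rewrite /a mulrA.
have D0 : 0 < s * a ^+ 2 * (expR a - rho).
  by apply: mulr_gt0 => //; exact: mulr_gt0.
have K_ge : expR a / (10 * a ^+ 2) <= K.
  rewrite KE ler_pdivlMr//.
  have -> : expR a / (10 * a ^+ 2) * (s * a ^+ 2 * (expR a - rho)) =
      expR a * (s * (expR a - rho)) / 10 by field; rewrite gt_eqF.
  have sD : s * (expR a - rho) <= 2 * (5 * expR a) by apply: ler_pM => //; lra.
  have : expR a * (s * (expR a - rho)) <= expR a * (2 * (5 * expR a)).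
    by rewrite ler_pM2l.
  by lra.
split; first by rewrite KE; apply: divr_gt0 => //; exact: exprn_gt0.
(* 320 = 32 * 10: the 10 comes from [K_ge], and 2 / s^2 <= 32 because s >= 1/4. *)
apply: (@le_trans _ _ (320 * (expR a / (10 * a ^+ 2)))); last by rewrite ler_pM2l ?ltr0n.
have -> : 320 * (expR a / (10 * a ^+ 2)) = 32 * expR a / a ^+ 2.
  by field; rewrite gt_eqF.
rewrite qE; have [_|_] := leP (s ^+ 2 * a ^+ 2 / 2) 1; last first.
  by rewrite invr1 ler_pdivlMr//; nra.
rewrite -[leLHS]div1r ler_pdivrMr; last by rewrite divr_gt0// mulr_gt0// exprn_gt0.
rewrite mulrAC ler_pdivlMr// mul1r.
have : 1 <= expR a by rewrite -[leLHS]expR0 ler_expR ltW.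
have : 1 / 16 <= s ^+ 2 by nra.
move=> hs he.
have : 1 / 16 * 1 <= s ^+ 2 * expR a by apply: ler_pM => //; lra.
move=> hse; have : 1 / 16 * a ^+ 2 <= s ^+ 2 * expR a * a ^+ 2 by apply: ler_pM => //; lra.
by lra.
Qed.

End RateConstant.

(** * Existence of R_i with the required order of magnitude *)

Section ReturnTail.
Context {R : realType} {S : countType}.
Variables (p : S -> S -> R) (d : measure_display) (T : measurableType d)
  (Pr : S -> probability T R) (X : nat -> T -> S).
Hypothesis family : markov_family p Pr X.
Hypothesis pos_rec : positive_recurrent Pr X.
Hypothesis irr : irreducible_chain Pr X.

Let p_ge0 x y : 0 <= p x y. Proof. by case: family => -[]. Qed.

(* The property propagates along transitions of positive probability. *)
Lemma occupation_bounded i x : exists M : R,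
  forall n, (occupation p [set i] setT n x <= M%:E)%E.
Proof.
pose F x := exists M : R, forall n, (occupation p [set i] setT n x <= M%:E)%E.
have Fi : F i.
  have := pos_rec i; set I := (\int[_]_w _)%E => Ioo.
  have occI n : (occupation p [set i] setT n i <= I)%E.
    exact: (occupation_le_return_time i p_ge0 (proj2 family i)).
  have I0 : (0 <= I)%E := le_trans (occupation_ge0 _ p_ge0 _ _ _) (occI 0%N).
  by exists (fine I) => n; rewrite fineK// ge0_fin_numE.
suff : F x by [].
apply: (@reachable_closed R S p d T Pr X F i x family irr _ Fi) => y z [M HM] pyz.
have [->//|/eqP zi] := eqVneq z i.
(* A step from [y] to [z] other than [i] survives the killing, so the occupation from [y] with
   horizon n + 1 is at least p(y, z) times the one from [z] with horizon n. *)
exists (M / p y z) => n; rewrite EFinM lee_pdivlMr// muleC.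
apply: le_trans (HM n.+1); rewrite occupationS//.
apply: le_trans (leeDr _ _); last by rewrite lee_fin.
apply: taboo_ge1 => // w.
exact: occupation_ge0.
Qed.

Lemma return_tail_rate (V : S -> R) (nu gamma b : R) (i : S) :
  lyapunov p Pr X V nu gamma b -> V i <= b ->
  exists Ri : R, [/\ 0 < Ri, return_tail Pr X i Ri
    & (Ri%:E <= 3840%:E * rate_bound
        (max_observed_return Pr X [set x | (V x <= b)%R] i) nu gamma)%E].
Proof.
move=> lyap Bi; set B := [set x | V x <= b].
have [[nu0 gamma0 b0] V0 finB _ _] := lyap.
(* The supremum over horizons and starts in [B] is finite because [B] is finite and each occupation
   is bounded. It lies below H_i^B, whose own finiteness is thus never an issue. *)
pose hbar := ereal_sup [set occupation p [set i] B u.1 u.2 | u in [set: nat] `*` B].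
have occ_hbar n x : B x -> (occupation p [set i] B n x <= hbar)%E.
  by move=> Bx; apply: ereal_sup_ubound; exists (n, x).
have hbar_ge1 : (1 <= hbar)%E.
  apply: le_trans (occ_hbar 1%N i Bi).
  by rewrite /occupation big_ord1 /= indicE mem_set.
have [M HM] : exists M : R, (hbar <= M%:E)%E.
  have /choice[M HM] := occupation_bounded i.
  have M0 x : (0 <= M x)%R.
    by rewrite -lee_fin; apply: le_trans (HM x 0%N); exact: occupation_ge0.
  exists (\sum_(x <- finmap.enum_fset (fset_set B)) M x).
  apply: ge_ereal_sup => _ [[n x] [_ /= Bx] <-].
  apply: le_trans (_ : (M x)%:E <= _)%E.
    apply: le_trans (HM x n); apply: lee_sum => t _; exact: le_visit.
  rewrite lee_fin (big_rem x)/=; last by rewrite in_fset_set// mem_set.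
  by rewrite lerDl sumr_ge0.
have hbarE : hbar = (fine hbar)%:E.
  rewrite fineK// ge0_fin_numE; last exact: le_trans hbar_ge1.
  exact: le_lt_trans HM (ltry _).
set h := fine hbar in hbarE.
have h1 : 1 <= h by rewrite -lee_fin -hbarE.
have h0 : 0 < h by lra.
have hbarH : (hbar <= max_observed_return Pr X B i)%E.
  apply: ge_ereal_sup => _ [[n x] [_ /= Bx] <-].
  apply: le_trans (occupation_le_observed_return_time i p_ge0 (proj2 family x) B n) _.
  by apply: ereal_sup_ubound; exists x.
have occ_h n x : B x -> (occupation p [set i] B n x <= h%:E)%E.
  by rewrite -hbarE; exact: occ_hbar.
have [K0 HK] := rate_constant nu0 gamma0.
have tail n := survive_geometric family lyap Bi occ_h n h1.
set q1 := Num.min _ _ in HK tail.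
have q1_0 : 0 < q1.
  by rewrite lt_min ltr01 andbT divr_gt0 ?exprn_gt0// mulr_gt0// exprn_gt0.
have q11 : q1 <= 1 by rewrite ge_min lexx orbT.
set dl := q1 / (12 * h) in tail.
have dl0 : 0 < dl by rewrite divr_gt0// mulr_gt0.
have dl1 : dl <= 1 by rewrite ler_pdivrMr ?mulr_gt0//; lra.
have l2 : 0 < ln 2 :> R by rewrite ln_gt0// ltr1n.
have l21 : ln 2 <= 1 :> R by rewrite -[2]/(1 + 1) le_ln1Dx//; lra.
exists (ln 2 / dl); split.
- by rewrite divr_gt0.
- move=> k k0; rewrite (return_time_survive i p_ge0 (proj2 family i)).
  apply: le_trans (tail k) _; rewrite lee_fin ler_pM2l// powR2_rate ?gt_eqF//.
  exact: expRN_natr_ge_pow.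
rewrite /rate_bound.
set K := (_ / _) in K0 HK *.
apply: le_trans (_ : (3840%:E * (hbar * K%:E) <= _)%E); last first.
  apply: lee_wpmul2l; first by rewrite lee_fin ler0n.
  by apply: lee_wpmul2r => //; rewrite lee_fin ltW.
rewrite hbarE -!EFinM lee_fin.
have -> : ln 2 / dl = ln 2 * (12 * h * q1^-1) by rewrite /dl invf_div.
apply: (@le_trans _ _ (1 * (12 * h * (320 * K)))); last first.
  by rewrite le_eqVlt; apply/orP; left; apply/eqP; ring.
have h12 : 0 < 12 * h by rewrite mulr_gt0.
apply: ler_pM => //; [exact: ltW| |by rewrite ler_pM2l].
by apply: mulr_ge0; [exact: ltW|rewrite invr_ge0 ltW].
Qed.

End ReturnTail.

(** * Chernoff's bound *)

Section Chernoff.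
Import numFieldNormedType.Exports.
Context {R : realType}.

(** The Padé bound exp y <= (2 + y) / (2 - y), multiplied out. The difference of the two sides
    vanishes at 0 and has derivative 1 - (1 - t) exp t >= 0. *)
Lemma expR_le_pade (y : R) : 0 <= y -> (2 - y) * expR y <= 2 + y.
Proof.
move=> y0; rewrite -subr_ge0.
pose g (t : R) := 2 + t - (2 - t) * expR t.
have dg (t : R) : is_derive t 1 g (1 - (1 - t) * expR t).
  rewrite /g; apply: is_derive_eq.
  by rewrite /GRing.scale/=; ring.
have -> : 2 + y - (2 - y) * expR y = g y by [].
have <- : g 0 = 0 by rewrite /g expR0; ring.
have := @ger0_derive1_le_cc R g 0 y.
move=> /(_ _ _ _ 0 y); apply => //.
- move=> t _; rewrite derive1E derive_val subr_ge0.
  have := expR_ge1Dx (- t); rewrite expRN => h.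
  by rewrite -ler_pdivlMr ?expR_gt0// mul1r.
- apply: continuous_subspaceT => t.
  by apply: differentiable_continuous; apply/derivable1_diffP; exact: ex_derive.
- by rewrite in_itv/= lexx.
- by rewrite in_itv/= lexx y0.
Qed.

Lemma chernoff_upper_rate (e : R) : 0 < e < 1 ->
  exists2 t, 0 < t & expR t - 1 - t * (1 + e) <= - (e ^+ 2 / 3).
Proof.
(* The optimal t is ln(1 + e). Its rational approximation 2 e / (2 + e) solves (2 + t) / (2 - t) = 1
   + e, so exp t <= 1 + e and the exponent is at most -e^2 / (2 + e). *)
move=> /andP[e0 e1]; pose t := 2 * e / (2 + e).
have t0 : 0 < t by rewrite divr_gt0//; lra.
have tE : t * (2 + e) = 2 * e by rewrite /t divfK// gt_eqF//; lra.
exists t => //.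
have h := expR_le_pade (ltW t0).
have ht : expR t <= 1 + e.
  have t2 : 0 < 2 - t by nra.
  by rewrite -(ler_pM2l t2); apply: le_trans h _; nra.
have : e ^+ 2 / 3 <= e ^+ 2 / (2 + e).
  by rewrite ler_pM2l ?exprn_gt0// lef_pV2 ?posrE; lra.
have -> : t * (1 + e) = e + e ^+ 2 / (2 + e) by rewrite /t; field; rewrite gt_eqF//; lra.
by lra.
Qed.

(** The parameter is -e in place of the optimal ln(1 - e). Replacing exp(e) by (1 + e / 4)^4 reduces
    the claim to a polynomial inequality whose expansion has only positive coefficients. *)
Lemma chernoff_lower_rate (e : R) : 0 < e < 1 ->
  expR (- e) - 1 + e * (1 - e) <= - (e ^+ 2 / 3).
Proof.
move=> /andP[e0 e1].
have h : 1 + e / 4 <= expR (e / 4) by exact: expR_ge1Dx.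
have h4 : (1 + e / 4) ^+ 4 <= expR e.
  have -> : expR e = expR (e / 4) ^+ 4 by rewrite -expRM_natl; congr expR; lra.
  by apply: lerXn2r => //; rewrite nnegrE ?expR_ge0//; lra.
have h5 : 0 < (1 + e / 4) ^+ 4 by rewrite exprn_gt0//; lra.
suff : expR (- e) <= 1 - e + 2 * e ^+ 2 / 3 by lra.
rewrite expRN; apply: (@le_trans _ _ ((1 + e / 4) ^+ 4)^-1).
  by rewrite lef_pV2 ?posrE// expR_gt0.
rewrite -[leLHS]div1r ler_pdivrMr//.
have e2 : 0 < e ^+ 2 by rewrite exprn_gt0.
have e3 : 0 < e ^+ 3 by rewrite exprn_gt0.
have e4 : 0 < e ^+ 4 by rewrite exprn_gt0.
have e5 : 0 < e ^+ 5 by rewrite exprn_gt0.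
have e6 : 0 < e ^+ 6 by rewrite exprn_gt0.
have -> : (1 - e + 2 * e ^+ 2 / 3) * (1 + e / 4) ^+ 4 =
  1 + e ^+ 2 / 24 + e ^+ 3 * (17 / 48) + e ^+ 4 * (49 / 256) +
  e ^+ 5 * (29 / 768) + e ^+ 6 / 384.
  by field.
by lra.
Qed.

(** Convexity: the tangent of exp at t u lies below exp at 0 and at t; averaging with weights 1 - u
    and u gives the chord. *)
Lemma expR_chord (t u : R) : 0 <= u <= 1 -> expR (t * u) <= 1 + u * (expR t - 1).
Proof.
move=> /andP[u0 u1].
have h1 : (1 - t * u) * expR (t * u) <= 1.
  have := expR_ge1Dx (- (t * u)); rewrite expRN => h.
  by rewrite -ler_pdivlMr ?expR_gt0// mul1r.
have h2 : (1 + (t - t * u)) * expR (t * u) <= expR t.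
  have := expR_ge1Dx (t - t * u); rewrite expRB => h.
  by rewrite -ler_pdivlMr ?expR_gt0.
have h3 : (1 - u) * ((1 - t * u) * expR (t * u)) <= (1 - u) * 1.
  by rewrite ler_wpM2l// subr_ge0.
have h4 : u * ((1 + (t - t * u)) * expR (t * u)) <= u * expR t.
  by rewrite ler_wpM2l.
by lra.
Qed.

Variables (N : nat) (mu : 'I_N.+1 -> R).
Hypothesis N0 : (0 < N)%N.
Hypothesis mu0 : forall l, 0 <= mu l.
Hypothesis mu1 : \sum_l mu l = 1.

Let m := \sum_l mu l * (l : nat)%:R.

Let N0' : 0 < N%:R :> R. Proof. by rewrite ltr0n. Qed.

(** The sign of [t] selects the tail, so one statement covers both. Lengths are divided by [N] to
    lie in [0, 1], whence the factor m / N in the exponent. *)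
Lemma chernoff_exponential n (t a : R) (A : pred {ffun 'I_n -> 'I_N.+1}) :
  (forall f, A f -> 0 <= t * ((\sum_s (f s : nat)%:R) - a * (n%:R * m))) ->
  \sum_(f | A f) \prod_s mu (f s) <=
  expR (n%:R * m / N%:R * (expR t - 1 - t * a)).
Proof.
move=> hA.
pose c := expR (- (t * a * (n%:R * m) / N%:R)).
have prod_ge0 (f : {ffun 'I_n -> 'I_N.+1}) : 0 <= \prod_s mu (f s).
  exact: prodr_ge0.
apply: (@le_trans _ _ (\sum_(f : {ffun 'I_n -> 'I_N.+1})
    \prod_s (mu (f s) * expR (t * ((f s : nat)%:R / N%:R))) * c)).
  rewrite big_mkcond/=; apply: ler_sum => f _; case: ifPn => [Af|_]; last first.
    by rewrite mulr_ge0 ?expR_ge0// prodr_ge0// => s _; rewrite mulr_ge0// expR_ge0.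
  rewrite big_split/= -expR_sum -mulrA -expRD ler_peMr// -[leLHS]expR0 ler_expR.
  rewrite -mulr_sumr -mulr_suml.
  have -> : t * ((\sum_s (f s : nat)%:R) / N%:R) + - (t * a * (n%:R * m) / N%:R) =
      t * ((\sum_s (f s : nat)%:R) - a * (n%:R * m)) / N%:R by ring.
  by rewrite divr_ge0 ?hA// ltW.
rewrite -mulr_suml -(bigA_distr_bigA (fun (_ : 'I_n) (l : 'I_N.+1) =>
  mu l * expR (t * ((l : nat)%:R / N%:R)))) /=.
rewrite prodr_const card_ord.
have hE : \sum_l mu l * expR (t * ((l : nat)%:R / N%:R)) <=
    expR (m / N%:R * (expR t - 1)).
  apply: le_trans (expR_ge1Dx _).
  apply: (@le_trans _ _ (\sum_l mu l * (1 + (l : nat)%:R / N%:R * (expR t - 1)))).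
    apply: ler_sum => l _; apply: ler_wpM2l => //; apply: expR_chord.
    by rewrite divr_ge0//= ler_pdivrMr// mul1r ler_nat -ltnS.
  rewrite le_eqVlt; apply/orP; left; apply/eqP.
  transitivity (\sum_l mu l + m / N%:R * (expR t - 1)); last by rewrite mu1.
  by rewrite /m !mulr_suml -big_split/=; apply: eq_bigr => l _; ring.
have -> : n%:R * m / N%:R * (expR t - 1 - t * a) =
    n%:R * (m / N%:R * (expR t - 1)) + - (t * a * (n%:R * m) / N%:R) by ring.
rewrite expRD expRM_natl; apply: ler_wpM2r; first exact: expR_ge0.
apply: lerXn2r => //; rewrite nnegrE ?expR_ge0//.
by apply: sumr_ge0 => l _; rewrite mulr_ge0// expR_ge0.
Qed.

Lemma chernoff_two_sided n (e : R) : 0 < e < 1 ->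
  \sum_(f : {ffun 'I_n -> 'I_N.+1} |
      e * m < `|(\sum_s (f s : nat)%:R) / n%:R - m|) \prod_s mu (f s) <=
  2 * expR (- (n%:R * m / N%:R * (e ^+ 2 / 3))).
Proof.
move=> e01; have /andP[e0 e1] := e01.
have m0 : 0 <= m by apply: sumr_ge0 => l _; rewrite mulr_ge0.
have prod_ge0 (f : {ffun 'I_n -> 'I_N.+1}) : 0 <= \prod_s mu (f s).
  exact: prodr_ge0.
have nm0 : 0 <= n%:R * m / N%:R by rewrite divr_ge0// ?mulr_ge0// ltW.
pose A1 (f : {ffun 'I_n -> 'I_N.+1}) := 0 <= (\sum_s (f s : nat)%:R) - (1 + e) * (n%:R * m).
pose A2 (f : {ffun 'I_n -> 'I_N.+1}) := (\sum_s (f s : nat)%:R) - (1 - e) * (n%:R * m) <= 0.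
apply: (@le_trans _ _ (\sum_(f | A1 f) \prod_s mu (f s) + \sum_(f | A2 f) \prod_s mu (f s))).
  rewrite big_mkcond (big_mkcond A1) (big_mkcond A2) -big_split/=.
  apply: ler_sum => f _; case: ifPn => [bad|_]; last first.
    by rewrite addr_ge0//; case: ifP.
  suff : A1 f || A2 f.
    by move=> /orP[->|->]; [rewrite lerDl|rewrite lerDr]; case: ifP.
  apply/orP; rewrite /A1 /A2.
  (* For n = 0 the empty mean is 0 / 0 = 0, which may count as a deviation; [A1] then holds as 0 <=
     0. *)
  have [n0|n0] := eqVneq n 0%N.
    have nR : n%:R = 0 :> R by rewrite n0.
    by left; rewrite nR mul0r mulr0 subr0 sumr_ge0.
  have n0' : 0 < n%:R :> R by rewrite ltr0n lt0n.
  move: bad; set Sf := \sum_s _; rewrite lter_normr => /orP[] h; [left|right].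
    have : (1 + e) * m <= Sf / n%:R by lra.
    by rewrite ler_pdivlMr//; lra.
  have : Sf / n%:R <= (1 - e) * m by lra.
  by rewrite ler_pdivrMr//; lra.
rewrite mulrDl mul1r; apply: lerD.
  have [t t0 ht] := chernoff_upper_rate e01.
  apply: le_trans (chernoff_exponential (t := t) (a := 1 + e) _) _.
    by move=> f Af; rewrite mulr_ge0// ltW.
  by rewrite ler_expR -[leRHS]mulrN ler_wpM2l.
have ht := chernoff_lower_rate e01.
apply: le_trans (chernoff_exponential (t := - e) (a := 1 - e) _) _.
  by move=> f Af; rewrite mulr_le0// oppr_le0 ltW.
by rewrite ler_expR -[leRHS]mulrN ler_wpM2l//; lra.
Qed.

End Chernoff.

(** * Iterated refinement *)

Section StoppedLength.
Context {S : countType}.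
Implicit Types (x : nat -> S) (i : S).

Lemma stopped_length_le x i n : (0 < n)%N -> (stopped_length x i n <= n)%N.
Proof.
move=> n0; rewrite /stopped_length -[X in (_ < X)%N](size_iota 1) -has_find.
by apply/hasP; exists n; rewrite ?eqxx// mem_iota n0 add1n ltnS leqnn.
Qed.

Lemma stopped_length_gt x i n k : (k < n)%N ->
  (k < stopped_length x i n)%N <-> (forall t, (0 < t <= k)%N -> x t <> i).
Proof.
move=> kn; rewrite /stopped_length ltnS; set a := fun t => _; split.
  move=> kf t /andP[t0 tk] xt.
  have := @before_find _ 0%N a (iota 1 n) t.-1.
  rewrite prednK// (leq_trans tk kf) nth_iota; last by rewrite prednK// (leq_trans tk)// ltnW.
  by rewrite add1n prednK// /a xt eqxx orbT => /(_ isT).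
move=> h; rewrite leqNgt; apply/negP => fk.
have /(nth_find 0%N) : has a (iota 1 n) by rewrite has_find size_iota (ltn_trans fk).
rewrite nth_iota ?(ltn_trans fk)// add1n /a => /orP[/eqP E|/eqP].
  by move: (leq_ltn_trans fk kn); rewrite E ltnn.
by apply: h; rewrite /= fk.
Qed.

Context {R : realType} (d : measure_display) (T : measurableType d).
Variables (X : nat -> T -> S) (i : S) (n : nat).
Hypothesis n0 : (0 < n)%N.

(** Independence is stated for events of [process_sigma]. Being longer than k means avoiding [i] at
    times 1, ..., k, an intersection of such events. *)
Lemma process_sigma_stopped_length l :
  process_sigma X [set w | stopped_length (X ^~ w) i n = l].
Proof.
set G := [set E | exists t (A : set S), E = X t @^-1` A].
rewrite -[process_sigma X]/(@measurable _ (g_sigma_algebraType G)).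
have mX t A : @measurable _ (g_sigma_algebraType G) (X t @^-1` A).
  by apply: sub_sigma_algebra; exists t, A.
have mle k : @measurable _ (g_sigma_algebraType G)
    [set w | (k <= stopped_length (X ^~ w) i n)%N].
  case: k => [|k]; first by rewrite (_ : [set w | _] = setT)//; exact/seteqP.
  have [kn|nk] := ltnP k n; last first.
    rewrite (_ : [set w | _] = set0)//; apply/seteqP; split=> // w /=.
    move=> kS; have := leq_trans kS (stopped_length_le (X ^~ w) i n0).
    by rewrite ltnNge nk.
  rewrite (_ : [set w | _] = \bigcap_(t in [set t | (0 < t <= k)%N]) X t @^-1` (~` [set i])).
    exact: bigcap_measurableType.
  by apply/seteqP; split => w /= /(stopped_length_gt _ _ kn).
rewrite (_ : [set w | _] = [set w | (l <= stopped_length (X ^~ w) i n)%N] `\`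
    [set w | (l.+1 <= stopped_length (X ^~ w) i n)%N]); first exact: measurableD.
apply/seteqP; split => w /=; first by move=> ->; rewrite ltnn leqnn.
by move=> [ln /negP]; rewrite -leqNgt => nl; apply/eqP; rewrite eqn_leq nl ln.
Qed.

Variables (p : S -> S -> R) (P : probability T R).
Hypothesis p_ge0 : forall a b, 0 <= p a b.
Hypothesis XP : markov_chain p i P X.

Lemma measurable_stopped_length (A : set nat) :
  measurable ((fun w => stopped_length (X ^~ w) i n) @^-1` A).
Proof.
have mX t B : measurable (X t @^-1` B) by case: XP.
have -> : (fun w => stopped_length (X ^~ w) i n) @^-1` A =
    \bigcup_(l in A) [set w | stopped_length (X ^~ w) i n = l].
  by apply/seteqP; split => [w Aw|w [l Al /= ->]//]; exists (stopped_length (X ^~ w) i n).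
apply: bigcup_measurable => l _.
suff : process_sigma X `<=` measurable by apply; exact: process_sigma_stopped_length.
apply: smallest_sub; first exact: sigma_algebra_measurable.
by move=> _ [t [B ->]].
Qed.

Lemma stopped_length_law k : (k < n)%N ->
  P [set w | (k < stopped_length (X ^~ w) i n)%N] = visit p [set i] setT k i.
Proof.
move=> kn; rewrite -(markov_survive _ p_ge0 XP); congr (P _).
by apply/seteqP; split => w /= /(stopped_length_gt _ _ kn).
Qed.

End StoppedLength.

(** * Random sample sizes and conditioning on earlier iterations *)

Section Refinement.
Context {R : realType} {S : countType}.
Variables (p : S -> S -> R) (i : S).
Context (d : measure_display) (T : measurableType d) (Q : probability T R)
  (Z : nat -> nat -> nat -> T -> S).
Hypothesis p_ge0 : forall x y, 0 <= p x y.
Hypothesis simZ : simulations p i Q Z.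

Let L k s w := stopped_length (Z k s ^~ w) i (theta k).
Let z w : nat -> nat -> nat -> S := fun k s t => Z k s t w.

Lemma theta_gt0 k : (0 < theta k)%N. Proof. by rewrite expn_gt0. Qed.

Let mL k s (A : set nat) : measurable (L k s @^-1` A).
Proof.
by apply: (measurable_stopped_length (theta_gt0 k) (p := p) (P := Q)); case: simZ.
Qed.

Let mLset k s (A : pred nat) : measurable [set w | A (L k s w)].
Proof. exact: (mL k s [set l | A l]). Qed.

Let mLeq k s l : measurable [set w | L k s w = l].
Proof. exact: (mL k s [set l]). Qed.

(** The survival function of a length depends on [p] and [i] alone, so all realizations of a row are
    identically distributed. *)
Lemma stopped_length_law0 k s l :
  Q [set w | L k s w = l] = Q [set w | L k 0 w = l].
Proof.
have gt s' n : Q [set w | (n < L k s' w)%N] =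
    if (n < theta k)%N then visit p [set i] setT n i else 0%E.
  case: ltnP => [nk|kn].
    by apply: stopped_length_law => //; case: simZ.
  rewrite (_ : [set w | _] = set0) ?measure0//; apply/seteqP; split=> // w /= kL.
  have := leq_trans kL (stopped_length_le (Z k s' ^~ w) i (theta_gt0 k)).
  by rewrite ltnNge kn.
have eq0 s' : Q [set w | L k s' w = 0%N] = 0%E.
  by rewrite (_ : [set w | _] = set0) ?measure0//; apply/seteqP; split => w.
have eqS s' n : Q [set w | L k s' w = n.+1] =
    (Q [set w | (n < L k s' w)%N] - Q [set w | (n.+1 < L k s' w)%N])%E.
  rewrite (_ : [set w | L k s' w = n.+1] =
    [set w | (n < L k s' w)%N] `\` [set w | (n.+1 < L k s' w)%N]).
    rewrite measureD//.
      congr (_ - Q _)%E; apply/seteqP; split => [w []//|w /= nL].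
      by split => //; exact: ltnW.
    by rewrite -ge0_fin_numE// fin_num_measure//; exact: (mLset k s' (ltn n)).
  apply/seteqP; split => w /=; first by move=> ->; rewrite ltnn leqnn.
  by move=> [nL /negP]; rewrite -leqNgt => Ln; apply/eqP; rewrite eqn_leq Ln nL.
by case: l => [|n]; rewrite ?eq0// !eqS !gt.
Qed.

Let mu k (l : 'I_(theta k).+1) : R := fine (Q [set w | L k 0%N w = l]).
Arguments mu k l : clear implicits.

Let mu_ge0 k l : 0 <= mu k l. Proof. exact: fine_ge0. Qed.

Let muE k s (l : 'I_(theta k).+1) : Q [set w | L k s w = l] = (mu k l)%:E.
Proof. by rewrite stopped_length_law0 fineK// fin_num_measure. Qed.

Lemma stopped_length_sum_law k s (A : pred nat) :
  Q [set w | A (L k s w)] = (\sum_(l < (theta k).+1 | A l) mu k l)%:E.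
Proof.
rewrite -sumEFin; under eq_bigr do rewrite -(@muE k s).
rewrite -(measure_bigsetU_ord_cond Q (F := fun l : 'I_(theta k).+1 => [set w | L k s w = l]))//.
- congr (Q _); rewrite -(big_mkord A (fun l => [set w | L k s w = l])).
  rewrite -bigcup_seq_cond.
  apply/seteqP; split => [w /= Aw|w [l /= /andP[_ Al] Lwl]]; last by rewrite Lwl.
  exists (L k s w) => //=; rewrite Aw andbT mem_index_iota ltnS.
  by rewrite leq0n /=; apply: stopped_length_le; exact: theta_gt0.
- apply/trivIsetP => a b _ _ /eqP ab; rewrite -subset0 => w /= [La Lb].
  by apply: ab; apply: val_inj; exact: etrans (esym La) Lb.
Qed.

Let mu1 k : \sum_l mu k l = 1.
Proof.
apply: EFin_inj; rewrite -(stopped_length_sum_law k 0 predT) -[RHS](probability_setT Q).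
by congr (Q _); apply/seteqP; split => w.
Qed.

Let m k := \sum_l mu k l * (l : nat)%:R.

(** The mean of an integer variable is the sum of its survival probabilities. *)
Lemma mean_stopped_length k :
  (occupation p [set i] setT (theta k) i = (m k)%:E)%E.
Proof.
rewrite /occupation.
transitivity (\sum_(n < theta k) (\sum_(l < (theta k).+1 | (n < l)%N) mu k l)%:E)%E.
  apply: eq_bigr => n _; rewrite -(stopped_length_sum_law k 0 (fun l => n < l)%N).
  by apply/esym/stopped_length_law => //; case: simZ.
rewrite sumEFin; congr (_%:E); under eq_bigr do rewrite big_mkcond.
rewrite exchange_big/=; apply: eq_bigr => l _; rewrite -big_mkcond/=.
rewrite sumr_const mulr_natr; congr (_ *+ _).
rewrite -[LHS]sum1_card (eq_bigl (fun n : 'I_(theta k) => (n < l)%N))//.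
by rewrite -(big_ord_widen _ (fun=> 1%N)) ?sum1_card ?card_ord// -ltnS.
Qed.

(** A record of the lengths with indices in [J]. A record of all lengths read before iteration k
    fixes N^(k), so conditioning on the past becomes restriction to an atom. *)
Let atom (J : seq (nat * nat)) (l : nat * nat -> nat) : set T :=
  [set w | forall j, j \in J -> L j.1 j.2 w = l j].

Let matom J l : measurable (atom J l).
Proof.
rewrite [X in measurable X](_ : _ =
    \bigcap_(j in [set` J]) [set w | L j.1 j.2 w = l j])//.
by apply: fin_bigcap_measurable => //; exact: finite_seq.
Qed.

Lemma atom_prob J l : uniq J ->
  Q (atom J l) = (\prod_(j <- J) Q [set w | L j.1 j.2 w = l j])%E.
Proof.
move=> uJ; have [_ <-//] := simZ.
by move=> j jJ; apply: process_sigma_stopped_length; exact: theta_gt0.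
Qed.

Let row k n : seq (nat * nat) := [seq (k, s) | s <- iota 0 n].

(** Overwrites row k of the record by [f]. The default 0 stands at columns from [n] on, which
    [row k n] does not contain. *)
Let ext k n (f : {ffun 'I_n -> 'I_(theta k).+1}) (l : nat * nat -> nat) j :=
  if j.1 == k then oapp (fun s => f s : nat) 0%N (insub j.2) else l j.

Let atom_extE k n (f : {ffun 'I_n -> 'I_(theta k).+1}) J l w :
  (forall j, j \in J -> (j.1 < k)%N) ->
  atom (J ++ row k n) (ext f l) w <->
  atom J l w /\ (forall s : 'I_n, L k s w = f s).
Proof.
move=> Jk; split=> [h|[hJ hf] j].
  split=> [j jJ|s].
    have := h j; rewrite mem_cat jJ => /(_ isT) ->.
    by rewrite /ext ltn_eqF// Jk.
  have := h (k, val s); rewrite mem_cat map_f ?mem_iota ?orbT//= => /(_ isT) ->.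
  by rewrite /ext/= eqxx valK.
rewrite mem_cat => /orP[jJ|/mapP[s]].
  by rewrite /ext ltn_eqF ?Jk// hJ.
rewrite mem_iota => /= sn ->; rewrite /ext/= eqxx.
by rewrite (insubT (fun s => s < n)%N sn)/= -hf.
Qed.

Let atom_ext_prob k n (f : {ffun 'I_n -> 'I_(theta k).+1}) J l :
  uniq J -> (forall j, j \in J -> (j.1 < k)%N) ->
  Q (atom (J ++ row k n) (ext f l)) =
  (Q (atom J l) * (\prod_s mu k (f s))%:E)%E.
Proof.
move=> uJ Jk; rewrite !atom_prob//; last first.
  rewrite cat_uniq uJ map_inj_uniq ?iota_uniq ?andbT; last by move=> a b [].
  by apply/hasPn => _ /mapP[s _ ->]; apply/negP => /Jk; rewrite ltnn.
rewrite big_cat/= big_map -prodEFin; congr (_ * _)%E.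
  rewrite big_seq [RHS]big_seq; apply: eq_bigr => j jJ.
  by rewrite /ext ltn_eqF// Jk.
rewrite -[X in iota 0 X]subn0 big_mkord; apply: eq_bigr => s _.
by rewrite /ext/= eqxx valK /= -(@muE k s).
Qed.

Let sum_prod_mu k n :
  \sum_(f : {ffun 'I_n -> 'I_(theta k).+1}) \prod_s mu k (f s) = 1.
Proof.
rewrite -(bigA_distr_bigA (fun (_ : 'I_n) l => mu k l))/=.
by rewrite big1// => s _; exact: mu1.
Qed.

Lemma measure_le_sum (I : finType) (B : set T) (A : I -> set T) :
  measurable B -> (forall j, measurable (A j)) ->
  (forall w, B w -> exists j, A j w) -> (Q B <= \sum_j Q (A j))%E.
Proof.
move=> mB mA BA; apply: (@le_trans _ _ (Q (\big[setU/set0]_j A j))).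
  apply: le_measure; rewrite ?inE//; first exact: bigsetU_measurable.
  move=> w /BA[j Ajw]; rewrite -bigcup_seq; exists j => //=.
  by rewrite mem_index_enum.
elim: (index_enum I) => [|j r IH]; first by rewrite !big_nil measure0.
rewrite !big_cons; apply: le_trans (measureU2 Q _ _) _ => //.
  exact: bigsetU_measurable.
exact: leeD2l.
Qed.

Variables (eps alpha : R).
Hypothesis eps01 : 0 < eps < 1.
Hypothesis alpha01 : 0 < alpha < 1.

Let Th k w := T_hat eps alpha (z w) i k.
Let N k w := sample_size eps alpha (z w) i k.

(** Measurability for the discrete structure on the target, available because only countably many
    values occur. Division, logarithm and ceiling then compose freely. *)
Let mdisc (U : Type) (f : T -> U) := forall A : set U, measurable (f @^-1` A).

(** Handles averages over a random number of samples, by splitting along the value of that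
    number. *)
Let mdisc_bind (U : Type) (f : T -> nat) (g : nat -> T -> U) :
  mdisc f -> (forall n, mdisc (g n)) -> mdisc (fun w => g (f w) w).
Proof.
move=> mf mg A.
have -> : (fun w => g (f w) w) @^-1` A =
    \bigcup_n (f @^-1` [set n] `&` g n @^-1` A).
  by apply/seteqP; split=> [w Aw|w [n _ [/= <-]]//]; exists (f w).
apply: bigcupT_measurable => n; apply: measurableI; [exact: mf|exact: mg].
Qed.

Let mdisc_comp (U W : Type) (g : U -> W) (f : T -> U) : mdisc f -> mdisc (g \o f).
Proof. by move=> mf A; exact: (mf (g @^-1` A)). Qed.

Let mean_lengthE w k n :
  mean_length (z w) i k n = (\sum_(s < n) L k s w)%N%:R / n%:R :> R.
Proof. by rewrite /mean_length natr_sum. Qed.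

Let mdisc_mean k n : mdisc (fun w => mean_length (z w) i k n : R).
Proof.
rewrite (_ : (fun w => _) = (fun q : nat => q%:R / n%:R : R) \o
    (fun w => \sum_(s < n) L k s w)%N); last first.
  by apply/funext => w; rewrite mean_lengthE.
apply: mdisc_comp; elim: n => [|n IH].
  rewrite (_ : (fun w => _) = fun=> 0%N); last by apply/funext => w; rewrite big_ord0.
  by move=> A; rewrite preimage_cst; case: ifP.
rewrite (_ : (fun w => _) = fun w => (fun q w => (q + L k n w)%N)
    (\sum_(s < n) L k s w)%N w); last by apply/funext => w; rewrite big_ord_recr.
apply: (mdisc_bind (g := fun q w => (q + L k n w)%N)) => // q.
by apply: (mdisc_comp (addn q)) => A; exact: mL.
Qed.

Let mdisc_N k : mdisc (N k).
Proof.
elim: k => [|[|k] IH]; [by move=> A; rewrite /N /= preimage_cst; case: ifP..|].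
rewrite /N; apply: (mdisc_comp (fun t : R => `| Num.ceil (3 * (1 + eps) *
    (theta k.+2)%:R * ln (4 * (theta k.+2)%:R / alpha) / (t * eps ^+ 2)) |%N)).
exact: (mdisc_bind IH (mdisc_mean k.+1)).
Qed.

Lemma measurable_T_hat k (A : set R) : measurable [set w | A (Th k w)].
Proof. exact: (mdisc_bind (mdisc_N k) (mdisc_mean k) A). Qed.

Let Bad k w := eps * m k < `|Th k w - m k|.

Let mBad k : measurable [set w | Bad k w].
Proof. exact: (measurable_T_hat k [set t | eps * m k < `|t - m k|]). Qed.

(** Failure within [r] iterations from k on; the finite horizon permits induction on [r]. *)
Let Fail k r := [set w | exists k', (k <= k' < k + r)%N /\ Bad k' w].

Let mFail k r : measurable (Fail k r).
Proof.
rewrite [X in measurable X](_ : _ =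
    \bigcup_(k' in [set k' | (k <= k' < k + r)%N]) [set w | Bad k' w]).
  by apply: bigcup_measurable => k' _; exact: mBad.
by apply/seteqP; split => w [k' ]; [move=> [h1 h2]|move=> h1 h2]; exists k'.
Qed.

Let mE k : (occupation p [set i] setT (theta k) i = (m k)%:E)%E.
Proof. exact: mean_stopped_length. Qed.

Let m_ge1 k : 1 <= m k.
Proof.
rewrite -lee_fin -mE -(prednK (theta_gt0 k)) occupationS// indicE in_setT.
by rewrite leeDl// taboo_ge0// => y; exact: occupation_ge0.
Qed.

Let m_le k k' : (k <= k')%N -> m k <= m k'.
Proof.
move=> kk'; have tt : (theta k <= theta k')%N by rewrite leq_exp2l.
rewrite -lee_fin -!mE -(subnKC tt) /occupation big_split_ord/=.
by rewrite leeDl//; apply: sume_ge0 => t _; exact: visit_ge0.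
Qed.

Let log_size k := ln (4 * (theta k)%:R / alpha).

(** The Chernoff exponent reaches ln(4 theta / alpha), so the two tails together have probability at
    most 2 alpha / (4 theta) = alpha / 2^(k+1). *)
Let enough k n := log_size k <= n%:R * m k / (theta k)%:R * (eps ^+ 2 / 3).

Let theta_gt0R k : 0 < (theta k)%:R :> R.
Proof. by rewrite ltr0n theta_gt0. Qed.

Let log_size_gt0 k : 0 < log_size k.
Proof.
have /andP[a0 a1] := alpha01.
rewrite ln_gt0// ltr_pdivlMr// mul1r; apply: lt_le_trans a1 _.
by rewrite -natrM ler1n muln_gt0 theta_gt0.
Qed.

Lemma ler_absz_ceil (x : R) : x <= `|Num.ceil x|%N%:R.
Proof.
apply: le_trans (ceil_ge x) _.
by rewrite natr_absz ler_int ler_norm.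
Qed.

Let next_size k (t : R) := `| Num.ceil (3 * (1 + eps) *
  (theta k.+1)%:R * log_size k.+1 / (t * eps ^+ 2)) |%N.

Let N_next k w : (0 < k)%N -> N k.+1 w = next_size k (Th k w).
Proof. by case: k. Qed.

(** An accurate estimate satisfies t <= (1 + eps) m_k <= (1 + eps) m_(k+1), since truncated means
    increase with the threshold. The factor 3 (1 + eps) in the sample size offsets this and the 3 in
    Chernoff's exponent. *)
Let enough_next k t : `|t - m k| <= eps * m k -> enough k.+1 (next_size k t).
Proof.
have /andP[e0 e1] := eps01.
rewrite ler_norml => /andP[t1 t2].
have m1 := m_ge1 k; have mS := m_le (leqnSn k).
have t0 : 0 < t by nra.
have tm : t <= (1 + eps) * m k.+1 by nra.
have th0 := theta_gt0R k.+1; have l0 := log_size_gt0 k.+1.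
rewrite /enough; set l := log_size k.+1 in l0 *; set th := (theta k.+1)%:R in th0 *.
have := ler_absz_ceil (3 * (1 + eps) * th * l / (t * eps ^+ 2)).
rewrite -/(next_size k t); set n := (next_size k t)%:R => hn.
have e2 : 0 < eps ^+ 2 by rewrite exprn_gt0.
apply: (@le_trans _ _ (3 * (1 + eps) * th * l / (t * eps ^+ 2) *
    (m k.+1 / th * (eps ^+ 2 / 3)))); last first.
  have -> : n * m k.+1 / th * (eps ^+ 2 / 3) =
    n * (m k.+1 / th * (eps ^+ 2 / 3)) by rewrite !mulrA.
  by apply: ler_wpM2r => //; rewrite mulr_ge0// divr_ge0//; lra.
have -> : 3 * (1 + eps) * th * l / (t * eps ^+ 2) * (m k.+1 / th * (eps ^+ 2 / 3)) =
    l * ((1 + eps) * m k.+1 / t) by field; rewrite !gt_eqF.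
by rewrite ler_peMr ?(ltW l0)// ler_pdivlMr// mul1r.
Qed.

Let chernoff_size k n : enough k n ->
  2 * expR (- (n%:R * m k / (theta k)%:R * (eps ^+ 2 / 3))) <= alpha / 2 ^+ k.+1.
Proof.
have /andP[a0 a1] := alpha01.
move=> h; apply: (@le_trans _ _ (2 * expR (- log_size k))).
  by rewrite ler_pM2l// ler_expR lerN2.
rewrite expRN lnK ?posrE ?divr_gt0 ?mulr_gt0//.
rewrite /theta natrX exprS le_eqVlt; apply/orP; left; apply/eqP.
by field; rewrite !gt_eqF ?exprn_gt0.
Qed.

(* The sample size of iteration k is constant on the atom; splitting the atom
   along the lengths of row k yields atoms for iteration k + 1. *)
Lemma fail_bound r k J l n : uniq J -> (forall j, j \in J -> (j.1 < k)%N) ->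
  (0 < k)%N -> (forall w, atom J l w -> N k w = n) -> enough k n ->
  (Q (atom J l `&` Fail k r) <= Q (atom J l) * (alpha / 2 ^+ k)%:E)%E.
Proof.
have /andP[a0 a1] := alpha01.
elim: r k J l n => [|r IH] k J l n uJ Jk k0 Nn enk.
  rewrite (_ : _ `&` _ = set0) ?measure0.
    by rewrite mule_ge0// lee_fin divr_ge0 ?exprn_ge0// ltW.
  apply/seteqP; split=> // w [_ [k' [/andP[kk' +] _]]].
  by rewrite addn0 ltnNge kk'.
pose q := fine (Q (atom J l)).
have qE : Q (atom J l) = q%:E by rewrite fineK// fin_num_measure.
have q0 : 0 <= q by exact: fine_ge0.
pose A (f : {ffun 'I_n -> 'I_(theta k).+1}) := atom (J ++ row k n) (ext f l).
pose bad (f : {ffun 'I_n -> 'I_(theta k).+1}) :=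
  eps * m k < `|(\sum_s (f s : nat)%:R) / n%:R - m k|.
pose W (f : {ffun 'I_n -> 'I_(theta k).+1}) := \prod_s mu k (f s).
have W0 f : 0 <= W f by apply: prodr_ge0.
have QA f : Q (A f) = (q * W f)%:E by rewrite atom_ext_prob// qE EFinM.
have ThA f w : A f w -> Th k w = (\sum_s (f s : nat)%:R) / n%:R.
  move=> /(atom_extE _ _ _ Jk)[Jw fw].
  rewrite /Th /T_hat -/(N k w) (Nn _ Jw) mean_lengthE natr_sum.
  by congr (_ / _); apply: eq_bigr => s _; rewrite fw.
have uJ' : uniq (J ++ row k n).
  rewrite cat_uniq uJ map_inj_uniq ?iota_uniq ?andbT; last by move=> a b [].
  by apply/hasPn => _ /mapP[s _ ->]; apply/negP => /Jk; rewrite ltnn.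
have Jk' j : j \in J ++ row k n -> (j.1 < k.+1)%N.
  by rewrite mem_cat => /orP[/Jk/ltnW//|/mapP[s _ ->]] /=.
apply: (@le_trans _ _ (\sum_f Q (A f `&` Fail k r.+1))%E).
  apply: measure_le_sum => [|f|w [Jw Fw]].
  - by apply: measurableI; [exact: matom|exact: mFail].
  - by apply: measurableI; [exact: matom|exact: mFail].
  exists [ffun s : 'I_n => inord (L k s w)]; split => //.
  apply/(atom_extE _ _ _ Jk); split => // s; rewrite ffunE inordK// ltnS.
  by apply: stopped_length_le; exact: theta_gt0.
have bound f : (Q (A f `&` Fail k r.+1) <=
    (q * W f * ((bad f)%:R + alpha / 2 ^+ k.+1))%:E)%E.
  have c0 : 0 <= alpha / 2 ^+ k.+1 by rewrite divr_ge0 ?exprn_ge0// ltW.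
  case: (boolP (bad f)) => [bf|nbf].
    apply: (@le_trans _ _ (Q (A f))).
      by apply: measureIl; [exact: matom|exact: mFail].
    by rewrite QA lee_fin ler_peMr ?mulr_ge0// lerDl.
  (* On an atom where iteration k succeeds, any failure is a later one, and the induction hypothesis
     applies to the extended record. *)
  have -> : A f `&` Fail k r.+1 = A f `&` Fail k.+1 r.
    apply/seteqP; split => w [Aw [k' [/andP[kk' kr] Bw]]]; split => //; exists k'.
      split => //; rewrite addSnnS kr andbT ltn_neqAle kk' andbT.
      apply/eqP => kE; move: Bw; rewrite -kE /Bad (ThA f)//; exact/negP.
    by split => //; rewrite (ltnW kk') -addSnnS.
  rewrite add0r EFinM -QA.
  apply: (IH _ _ _ (next_size k ((\sum_s (f s : nat)%:R) / n%:R))) => //.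
    by move=> w Aw; rewrite N_next// (ThA f).
  by apply: enough_next; rewrite leNgt.
apply: (@le_trans _ _ (\sum_f (q * W f * ((bad f)%:R + alpha / 2 ^+ k.+1))%:E)%E).
  by apply: lee_sum => f _; exact: bound.
rewrite sumEFin qE -EFinM lee_fin.
have -> : \sum_f q * W f * ((bad f)%:R + alpha / 2 ^+ k.+1) =
    q * (\sum_(f | bad f) W f + alpha / 2 ^+ k.+1).
  transitivity (\sum_f (q * (if bad f then W f else 0) +
      q * (alpha / 2 ^+ k.+1) * W f)).
    by apply: eq_bigr => f _; case: (bad f) => /=; ring.
  by rewrite big_split/= -!mulr_sumr -big_mkcond sum_prod_mu mulr1 mulrDr.
rewrite ler_wpM2l//.
(* One half of the budget pays for iteration k, the other for all later ones. *)
have -> : alpha / 2 ^+ k = alpha / 2 ^+ k.+1 + alpha / 2 ^+ k.+1.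
  by rewrite exprS; field; rewrite gt_eqF ?exprn_gt0.
rewrite lerD2r; apply: le_trans (chernoff_size enk).
by apply: chernoff_two_sided => //; exact: theta_gt0.
Qed.

(** Here theta = 2, so 8 = 4 theta and 6 = 3 theta; m >= 1 plays the part of the preceding
    estimate. *)
Let enough_first w : enough 1 (N 1 w).
Proof.
have /andP[e0 e1] := eps01; have m1 := m_ge1 1; have l0 := log_size_gt0 1.
have e2 : 0 < eps ^+ 2 by rewrite exprn_gt0.
have -> : N 1 w = `| Num.ceil (6 * (1 + eps) * log_size 1 / eps ^+ 2) |%N.
  by rewrite /N /log_size /theta expn1 -natrM.
have := ler_absz_ceil (6 * (1 + eps) * log_size 1 / eps ^+ 2).
rewrite /enough; set l := log_size 1 in l0 *; set n := (`| _ |%N)%:R => hn.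
rewrite /theta expn1.
apply: (@le_trans _ _ (6 * (1 + eps) * l / eps ^+ 2 * (m 1 / 2 * (eps ^+ 2 / 3)))).
  have -> : 6 * (1 + eps) * l / eps ^+ 2 * (m 1 / 2 * (eps ^+ 2 / 3)) =
      l * ((1 + eps) * m 1) by field; rewrite gt_eqF.
  by rewrite ler_peMr ?(ltW l0)//; nra.
have -> : n * m 1 / 2 * (eps ^+ 2 / 3) = n * (m 1 / 2 * (eps ^+ 2 / 3)).
  by rewrite !mulrA.
by apply: ler_wpM2r => //; rewrite mulr_ge0// divr_ge0//; lra.
Qed.

Let Fail_le r : (Q (Fail 1 r) <= (alpha / 2)%:E)%E.
Proof.
have [w0|T0] := pselect (exists w : T, True); last first.
  rewrite (_ : Fail 1 r = set0) ?measure0.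
    by have /andP[a0 _] := alpha01; rewrite lee_fin divr_ge0// ltW.
  by apply/seteqP; split => // w; exfalso; apply: T0; exists w.
have [w _] := w0.
have := @fail_bound r 1 [::] (fun=> 0%N) (N 1 w).
rewrite (_ : atom [::] _ = setT); last by apply/seteqP; split => // w' _ j.
rewrite setTI probability_setT mul1e expr1; apply => //.
Qed.

(** Continuity from below extends the bound alpha / 2 to all iterations, and alpha / 2 < alpha gives
    the strict inequality. Positivity of the estimate, offered to [A], follows from eps < 1 and a
    mean of at least 1. *)
Lemma refinement_success (mean : nat -> R) (A : nat -> set R) :
  (forall k, occupation p [set i] setT (theta k) i = (mean k)%:E) ->
  (forall k t, (1 <= k)%N -> 0 < t -> `|t - mean k| <= eps * mean k -> A k t) ->
  ((1 - alpha)%:E < Q [set w | forall k, (1 <= k)%N ->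
     A k (T_hat eps alpha (fun k s t => Z k s t w) i k)])%E.
Proof.
move=> meanE hA; have /andP[a0 a1] := alpha01; have /andP[e0 e1] := eps01.
have mean_m k : mean k = m k by apply: EFin_inj; rewrite -meanE mE.
have mF : measurable (\bigcup_r Fail 1 r) by exact: bigcupT_measurable.
have Fle : (Q (\bigcup_r Fail 1 r) <= (alpha / 2)%:E)%E.
  have cF : Q \o Fail 1 @ \oo --> Q (\bigcup_r Fail 1 r).
    apply: nondecreasing_cvg_mu => // a b ab; apply/subsetPset => w [k [/andP[k1 ka] Bk]].
    by exists k; rewrite k1 (leq_trans ka)// leq_add2l.
  rewrite -(cvg_lim _ cF)//; apply: lime_le; first by apply/cvg_ex; eexists; exact: cF.
  by apply: nearW => r; exact: Fail_le.
apply: (@lt_le_trans _ _ (Q (~` \bigcup_r Fail 1 r))).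
  rewrite probability_setC//.
  have : Q (\bigcup_r Fail 1 r) \is a fin_num by rewrite fin_num_measure.
  move: Fle; case: (Q (\bigcup_r Fail 1 r)) => [x||]//; rewrite lee_fin => xa _.
  by rewrite -EFinB lte_fin; lra.
apply: le_measure; rewrite ?inE//.
- exact: measurableC.
- rewrite [X in measurable X](_ : _ = \bigcap_(k in [set k | (1 <= k)%N])
      [set w | A k (Th k w)])//.
  by apply: bigcap_measurableType => k _; exact: measurable_T_hat.
move=> w nF k k1; rewrite -/(z w) -/(Th k w).
have mk := m_ge1 k.
have : `|Th k w - m k| <= eps * m k.
  rewrite leNgt; apply/negP => bad; apply: nF; exists k => //; exists k.
  by rewrite k1 add1n ltnSn.
move=> good; apply: hA => //; last by rewrite mean_m.
by move: good; rewrite ler_norml => /andP[h1 h2]; nra.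
Qed.

End Refinement.

(** * Deterministic error bound and conclusion *)

Lemma sum_geometric_le (R : realType) (x : R) (a n : nat) : 0 <= x < 1 ->
  \sum_(a <= k < n) x ^+ k <= x ^+ a / (1 - x).
Proof.
move=> /andP[x0 x1].
have [an|na] := leqP a n; last first.
  by rewrite big_geq ?(ltnW na)// divr_ge0 ?exprn_ge0// subr_ge0 ltW.
suff -> : \sum_(a <= k < n) x ^+ k = (x ^+ a - x ^+ n) / (1 - x).
  by rewrite ler_pM2r ?invr_gt0 ?subr_gt0// gerBl exprn_ge0.
rewrite -(subnKC an); elim: (n - a)%N => [|j IH].
  by rewrite addn0 big_geq// subrr mul0r.
rewrite addnS big_nat_recr ?leq_addr//= IH exprS; field.
by rewrite subr_eq0 gt_eqF.
Qed.

Lemma powR2_natr (R : realType) (c : R) (k : nat) :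
  2 `^ (- k%:R / c) = (2 `^ (- 1 / c)) ^+ k.
Proof.
rewrite -powR_mulrn ?powR_ge0// -powRrM; congr (_ `^ _).
by rewrite mulrAC mulN1r.
Qed.

(** The quotient is 1 - pi T = (1 - pi m) - pi (T - m), of size at most (1 - pi m) + e pi m = (1 -
    e) (1 - pi m) + e. *)
Lemma refinement_error (R : realType) (T m e pi t : R) :
  0 < T -> 0 <= pi -> 0 < e < 1 -> `|T - m| <= e * m ->
  0 <= 1 - pi * m <= pi * t ->
  `|(T^-1 - pi) / T^-1| <= (1 - e) * t * pi + e.
Proof.
move=> T0 pi0 /andP[e0 e1] Tm /andP[pm0 pmt].
have -> : (T^-1 - pi) / T^-1 = (1 - pi * m) - pi * (T - m).
  by field; rewrite gt_eqF.
apply: le_trans (ler_normB _ _) _; rewrite (ger0_norm pm0) normrM (ger0_norm pi0).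
have h1 : pi * `|T - m| <= pi * (e * m) by rewrite ler_wpM2l.
have h2 : (1 - e) * (1 - pi * m) <= (1 - e) * (pi * t).
  by rewrite ler_wpM2l// subr_ge0 ltW.
by lra.
Qed.

Theorem theorem8 (R : realType) :
  exists2 C : R, 0 < C &
  forall (S : countType) (p : S -> S -> R) (pi : S -> R)
    (d : measure_display) (T : measurableType d)
    (Pr : S -> probability T R) (X : nat -> T -> S)
    (V : S -> R) (nu gamma b : R),
  markov_family p Pr X ->
  positive_recurrent Pr X ->
  unique_stationary p pi ->
  irreducible_chain Pr X ->
  lyapunov p Pr X V nu gamma b ->
  let B := [set x | V x <= b] in
  forall i : S, B i ->
  (exists Ri : R,
     [/\ 0 < Ri, return_tail Pr X i Ri
       & (Ri%:E <= C%:E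
                   * rate_bound (max_observed_return Pr X B i) nu gamma)%E])
  /\
  (forall Ri : R, 0 < Ri -> return_tail Pr X i Ri ->
   forall eps alpha : R, 0 < eps < 1 -> 0 < alpha < 1 ->
   forall (d' : measure_display) (T' : measurableType d')
     (Q : probability T' R) (Z : nat -> nat -> nat -> T' -> S),
   simulations p i Q Z ->
   ((1 - alpha)%:E <
     Q [set w | (
        let z k s t := Z k s t w in
        forall k : nat, (1 <= k)%N ->
          `|(pi_hat eps alpha z i k - pi i) / pi_hat eps alpha z i k| <=
          4 * (1 - eps)
            * (2 `^ (- (theta k)%:R / Ri) / (1 - 2 `^ (- 1 / Ri)))
            * pi i + eps)%R])%E).

Proof.
(* 12 from the contraction rate times 320 from the comparison of constants; ln 2 is bounded by 1. *)
exists 3840; first by rewrite ltr0n.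
move=> S p pi d T Pr X V nu gamma b family pos_rec [pi_st _] irr lyap B i Bi.
split; first exact: (return_tail_rate family pos_rec irr lyap Bi).
move=> Ri Ri0 tail eps alpha eps01 alpha01 d' T' Q Z sim.
have p_tr : transition_matrix p by case: family.
have p_ge0 x y : 0 <= p x y by case: p_tr.
have occ := occupation_bounded family pos_rec irr i.
pose mean k : R := fine (occupation p [set i] setT (theta k) i).
have meanE k : occupation p [set i] setT (theta k) i = (mean k)%:E.
  have [M HM] := occ i; rewrite fineK// ge0_fin_numE ?occupation_ge0//.
  exact: le_lt_trans (HM (theta k)) (ltry _).
apply: (refinement_success p_ge0 sim eps01 alpha01 (mean := mean)
  (A := fun k => [set t | `|(t^-1 - pi i) / t^-1| <=
     4 * (1 - eps) * (2 `^ (- (theta k)%:R / Ri) / (1 - 2 `^ (- 1 / Ri))) *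
     pi i + eps])) => // k t k1 t0 tm /=.
set x := 2 `^ (- 1 / Ri).
have x01 : 0 <= x < 1.
  rewrite powR_ge0/= /x /powR pnatr_eq0/= expR_lt1 pmulr_llt0 ?ln_gt0 ?ltr1n//.
  by rewrite mulN1r oppr_lt0 invr_gt0.
(* The tail bound is assumed for positive indices only, and the sum starts at theta >= 1. *)
have tail_sum n :
    (\sum_(theta k <= j < n) visit p [set i] setT j i <=
     (4 * (x ^+ theta k / (1 - x)))%:E)%E.
  apply: (@le_trans _ _ (\sum_(theta k <= j < n) (4 * x ^+ j)%:E)%E).
    rewrite big_nat_cond [leRHS]big_nat_cond; apply: lee_sum => j /andP[/andP[kj _] _].
    rewrite -powR2_natr -(return_time_survive i p_ge0 (proj2 family i)).
    by apply: tail; apply: leq_trans kj; exact: theta_gt0.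
  by rewrite sumEFin lee_fin -mulr_sumr ler_pM2l// sum_geometric_le.
have kac := kac_truncated p_tr pi_st occ (meanE k) tail_sum.
have pi_ge0 : 0 <= pi i by case: pi_st.
have := refinement_error t0 pi_ge0 eps01 tm kac.
by rewrite powR2_natr -/x [4 * (1 - eps)]mulrC -(mulrA (1 - eps) 4).
Qed.
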